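(* Let $(M,\mathcal{T},I)$ be a weighted closed triangulated surface with $I\ge 0$ and $\chi(M)\le 0$, and let $\overline{R}\in C(V)$ be a given function on $V$. (1) (Euclidean background geometry) If $\overline{R}\equiv 0$, then there exists at most one Euclidean inversive distance circle packing metric $\overline{r}\in\Omega$, up to scaling $r\mapsto cr$ ($c>0$), whose $R$-curvature is identically $0$. If $\overline{R}\le 0$ and $\overline{R}\not\equiv 0$, then there exists at most one Euclidean inversive distance circle packing metric $\overline{r}\in\Omega$ whose $R$-curvature is $\overline{R}$. (2) (Hyperbolic background geometry) If $\overline{R}\le 0$, then there exists at most one hyperbolic inversive distance circle packing metric $\overline{r}\in\Omega$ whose $R$-curvature is $\overline{R}$.
   Context: $M$ is a closed surface with a triangulation $\mathcal{T}=\{V,E,F\}$ (vertices, edges, faces), $V=\{1,\dots,N\}$; $C(V)$ is the set of functions $V\to\mathbb{R}$, and inequalities between functions are pointwise. A weight is a function $I:E\to[0,+\infty)$ (written $I\ge0$), called the inversive distance; $(M,\mathcal{T},I)$ is a weighted triangulated surface. $\chi(M)$ is the Euler number. For $r\in\mathbb{R}^N_{>0}$, the length of an edge $\{ij\}\in E$ is $l_{ij}=\sqrt{r_i^2+r_j^2+2r_ir_jI_{ij}}$ in Euclidean background geometry, and $l_{ij}=\cosh^{-1}(\cosh r_i\cosh r_j+I_{ij}\sinh r_i\sinh r_j)$ in hyperbolic background geometry. The admissible space is $\Omega=\{r\in\mathbb{R}^N_{>0}: l_{ij}<l_{ik}+l_{kj},\ l_{ik}<l_{ij}+l_{jk},\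 l_{jk}<l_{ji}+l_{ik}\ \text{for all faces } \triangle ijk\in F\}$ (it depends on the background geometry). An element $r\in\Omega$ is called a (Euclidean, resp. hyperbolic) inversive distance circle packing metric. For $r\in\Omega$, each face $\triangle ijk$ is realized as a Euclidean (resp. hyperbolic) triangle with edge lengths $l_{ij},l_{jk},l_{ik}$, and $\theta_i^{jk}$ is its inner angle at $i$. The classical combinatorial Gauss curvature is $K_i=2\pi-\sum_{\triangle ijk\in F}\theta_i^{jk}$ (sum over faces having $i$ as a vertex). The $R$-curvature is $R_i=K_i/r_i^2$ in Euclidean background geometry and $R_i=K_i/\tanh^2\frac{r_i}{2}$ in hyperbolic background geometry. *)

(* Defs.v *)
From HB Require Import structures.
From mathcomp Require Import all_boot all_order all_algebra.
From mathcomp Require Import boolp reals sequences exp trigo.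

Set Implicit Arguments.
Unset Strict Implicit.
Unset Printing Implicit Defensive.

Import Order.TTheory GRing.Theory Num.Theory.

Local Open Scope ring_scope.

Section Combinatorics.
Variable N : nat.
Implicit Types (F : {set {set 'I_N}}) (i j k : 'I_N).

Definition edges_of F : {set {set 'I_N}} :=
  [set e : {set 'I_N} | (#|e| == 2) && [exists f in F, e \subset f]].

Definition adjacent F : rel 'I_N := fun i j => [set i; j] \in edges_of F.

(* The link of [i] (the graph on the vertices [j] in which [j] and [k] are
   joined when [{i, j, k}] is a face) is a simple cycle through the vertices
   listed in [s]. *)
Definition link_is_cycle F i (s : seq 'I_N) : Prop :=
  [/\ uniq s, (3 <= size s)%N &
      forall j k, ([set i; j; k] \in F) =
        [&& j \in s, k \in s & (k == next s j) || (j == next s k)]].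

End Combinatorics.

(* A triangulation, with vertex set ['I_N], of a nonempty connected closed
   surface (orientable or not), as an abstract simplicial complex given by its
   faces.  A finite 2-dimensional complex triangulates a closed surface exactly
   when the link of each vertex is a cycle; in particular every vertex lies in
   a face and every edge lies in exactly two faces. *)
Record triangulation (N : nat) := Triangulation {
  faces : {set {set 'I_N}};
  vertices_gt0 : (0 < N)%N;
  card_face : forall f, f \in faces -> #|f| = 3;
  vertex_link : forall i, exists s, link_is_cycle faces i s;
  vertices_connected : forall i j, connect (adjacent faces) i j
}.

Definition edges N (T : triangulation N) : {set {set 'I_N}} :=
  edges_of (faces T).

Definition euler_number N (T : triangulation N) : int :=
  N%:Z - #|edges T|%:Z + #|faces T|%:Z.

Section Hyperbolic.
Variable R : realType.
Implicit Types x y : R.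

Definition cosh x : R := (expR x + expR (- x)) / 2.
Definition sinh x : R := (expR x - expR (- x)) / 2.
Definition tanh x : R := sinh x / cosh x.

(* Meaningful for [1 <= y]; see [arcoshK] and [arcosh_ge0]. *)
Definition arcosh y : R := ln (y + Num.sqrt (y ^+ 2 - 1)).

Lemma arcosh_ge0 y : 1 <= y -> 0 <= arcosh y.
Proof. by move=> y1; rewrite ln_ge0// ler_wpDr// sqrtr_ge0. Qed.

Lemma arcoshK y : 1 <= y -> cosh (arcosh y) = y.
Proof.
move=> y1; have y2 : 0 <= y ^+ 2 - 1 by rewrite subr_ge0 exprn_ege1.
set s := Num.sqrt (y ^+ 2 - 1).
have ys : 0 < y + s by rewrite ltr_wpDr ?sqrtr_ge0// (lt_le_trans ltr01).
have inv : (y + s)^-1 = y - s.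
  apply: (mulfI (lt0r_neq0 ys)); rewrite mulfV ?lt0r_neq0// mulrC -subr_sqr.
  by rewrite sqr_sqrtr// subKr.
rewrite /cosh /arcosh -/s expRN lnK ?posrE// inv addrACA subrr addr0.
by rewrite -mulr2n -(mulr_natr y) mulfK// pnatr_eq0.
Qed.

End Hyperbolic.

Inductive background := Euclidean | Hyperbolic.

Section CirclePacking.
Variables (R : realType) (N : nat).
Variables (g : background) (T : triangulation N).
(* Only the values of a weight on the edges of [T] matter; likewise,
   [edge_length], [angle] and [inner_angle] below are meaningful only on the
   edges and faces of [T]. *)
Variable I : {set 'I_N} -> R.
Implicit Types (r : 'I_N -> R) (i j k : 'I_N).

Definition edge_length r i j : R :=
  match g with
  | Euclidean =>
      Num.sqrt (r i ^+ 2 + r j ^+ 2 + 2 * r i * r j * I [set i; j])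
  | Hyperbolic =>
      arcosh (cosh (r i) * cosh (r j) + I [set i; j] * sinh (r i) * sinh (r j))
  end.

(* [i], [j], [k] range over all orderings of the vertices of each face, so
   this covers the three strict triangle inequalities. *)
Definition admissible r : Prop :=
  (forall i, 0 < r i) /\
  (forall i j k, [set i; j; k] \in faces T ->
     edge_length r i j < edge_length r i k + edge_length r k j).

(* The angle between the sides of lengths [a] and [b] in a triangle with side
   lengths [a], [b], [c], by the law of cosines of the background geometry. *)
Definition angle (a b c : R) : R :=
  match g with
  | Euclidean => acos ((a ^+ 2 + b ^+ 2 - c ^+ 2) / (2 * a * b))
  | Hyperbolic => acos ((cosh a * cosh b - cosh c) / (sinh a * sinh b))
  end.

Definition inner_angle r i j k : R :=
  angle (edge_length r i j) (edge_length r i k) (edge_length r j k).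

(* The condition [j < k] selects each face containing [i] exactly once. *)
Definition curvature r i : R :=
  2 * pi - \sum_(j < N) \sum_(k < N | (j < k)%N && ([set i; j; k] \in faces T))
             inner_angle r i j k.

Definition R_curvature r i : R :=
  match g with
  | Euclidean => curvature r i / r i ^+ 2
  | Hyperbolic => curvature r i / tanh (r i / 2) ^+ 2
  end.

End CirclePacking.

(* Main.v *)
From mathcomp Require Import classical_sets topology normedtype derive realfun.
Require Import Defs.
From mathcomp Require Import all_boot all_order all_algebra.
From mathcomp Require Import boolp reals sequences exp trigo.
From mathcomp Require Import ring lra.
Import Order.TTheory GRing.Theory Num.Theory.
Import numFieldNormedType.Exports.
Local Open Scope ring_scope.

(** In the coordinates u_i = ln r_i (Euclidean) or u_i = ln tanh(r_i / 2)
    (hyperbolic) the angles of one triangle form a strictly monotone vector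
    field: if u and u' are admissible, then
    sum_i (u'_i - u_i) (theta_i(u') - theta_i(u)) <= 0, with equality only if u'
    is a scaling of u (Euclidean) or u' = u (hyperbolic).  Summed over the faces,
    this compares sum_i (u'_i - u_i) (K_i' - K_i) >= 0 with
    sum_i Rbar_i (u'_i - u_i) (w_i' - w_i) <= 0, where w_i = r_i^2 or
    tanh^2(r_i / 2) increases with u_i; so both sums vanish.

    On the admissible set the monotonicity is infinitesimal: the matrix
    (d theta_i / d u_j) is symmetric and negative (semi)definite.  Number the
    vertices so that I_12 r_1 r_2 (hyperbolic: I_12 tanh r_1 tanh r_2) is the
    largest of the three such products; then the angles at 1 and 2 are acute, and
    the leading minors in the order 3, 1, 2 of the opposite matrix are explicitly
    positive (the last one vanishes in the Euclidean case).  As the admissible set need not be convex in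
    u, the segment from u to u' may leave it.  There the angles are extended by
    the constants 0 and pi, and the extended function
    f = sum_i (u'_i - u_i) theta_i is still continuous; it decreases wherever the
    triangle is nondegenerate and takes finitely many values elsewhere, which is
    enough to make f(1) < f(0). *)

Set Implicit Arguments.
Unset Strict Implicit.
Unset Printing Implicit Defensive.

(** * The derivative of the angles of one triangle *)

Section Algebra.
Variable R : realFieldType.
Implicit Types k x y z e c d p s : R.

(* Both geometries are treated at once, with [k = 0] (Euclidean) or [k = 1]
   (hyperbolic).  An edge of length [l] is encoded by [z = l ^+ 2 / 2] or
   [z = cosh l - 1], so that [sq k z] is [l ^+ 2] or [sinh l ^+ 2]; the angle
   between the edges [x] and [y], opposite to [z], has the cosine
   [dot k x y z / sqrt (sq k x * sq k y)], and [disc k x y z] is positive exactly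
   for nondegenerate triangles.  Radii are encoded by [e] in the same way, and
   [c] is [I r_1 r_2] or [I sinh r_1 sinh r_2]; [grow k e1 e2 c] is the derivative
   of [side k e1 e2 c] with respect to [u_1]. *)
Definition sq k z := 2 * z + k * z ^+ 2.
Definition dot k x y z := x + y - z + k * x * y.
Definition disc k x y z := sq k x * sq k y - dot k x y z ^+ 2.
Definition side k e1 e2 c := e1 + e2 + k * e1 * e2 + c.
Definition grow k e1 e2 c := sq k e1 * (1 + k * e2) + (1 + k * e1) * c.
Definition dside k e1 e2 c d1 d2 := grow k e1 e2 c * d1 + grow k e2 e1 c * d2.

(* The derivative of the angle, multiplied by [sqrt (disc k x y z)]. *)
Definition dangle k x y z dx dy dz :=
  dz - dot k x z y / sq k x * dx - dot k y z x / sq k y * dy.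

(* The quadratic form of the Jacobian matrix of the angles at [(d1, d2, d3)], with
   the same factor; [zi] and [ci] belong to the edge opposite to the vertex [i]. *)
Definition triform k e1 e2 e3 c1 c2 c3 d1 d2 d3 :=
  let z1 := side k e2 e3 c1 in
  let z2 := side k e3 e1 c2 in
  let z3 := side k e1 e2 c3 in
  let z1' := dside k e2 e3 c1 d2 d3 in
  let z2' := dside k e3 e1 c2 d3 d1 in
  let z3' := dside k e1 e2 c3 d1 d2 in
  d1 * dangle k z2 z3 z1 z2' z3' z1' + d2 * dangle k z3 z1 z2 z3' z1' z2' +
  d3 * dangle k z1 z2 z3 z1' z2' z3'.

(* In the Euclidean case the angles are invariant under scaling. *)
Definition nontrivial k (d1 d2 d3 : R) : bool :=
  ~~ ((d1 == d2) && (d2 == d3)) || (k != 0) && [|| d1 != 0, d2 != 0 | d3 != 0].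

(* The polynomial of [minor_eq].  Its only terms of doubtful sign come from the
   last product, and [c2 <= c3] lets the first two products absorb them. *)
Lemma minor_gt0 k s1 s2 s3 p2 p3 c1 c2 c3 :
  0 <= k -> 0 < s1 -> 0 < s2 -> 0 < s3 ->
  0 <= p2 <= 1 -> 0 <= p3 <= 1 -> 0 <= c1 -> 0 <= c2 -> c2 <= c3 ->
  0 < (1 + k * c1) * (s1 * p2 + s2 + 2 * c3 + k * c3 ^+ 2) *
        (s3 + c1) * (s1 + c2) +
      (1 + k * c3) * (s2 + s3 * p2 + 2 * c1 + k * c1 ^+ 2) *
        (s3 + c2) * (s1 + c3) -
      p2 * (s1 * p3 + s3 + 2 * c2 + k * c2 ^+ 2) * (s3 + c1) * (s1 + c3).
Proof.
move=> k0 s1_gt0 s2_gt0 s3_gt0 /andP[p2_ge0 p2_le1] /andP[p3_ge0 p3_le1].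
move=> c1_ge0 c2_ge0 c23; have c3_ge0 := le_trans c2_ge0 c23.
have [[s1_ge0 s2_ge0] s3_ge0] := (ltW s1_gt0, ltW s2_gt0, ltW s3_gt0).
have c3c2 : p2 * c2 ^+ 2 * (s1 + c3) <= c3 ^+ 2 * (s1 + c2).
  rewrite -subr_ge0 [leRHS](_ : _ = (1 - p2) * c2 ^+ 2 * (s1 + c3) +
    (c3 - c2) * (s1 * (c3 + c2) + c2 * c3)); last by ring.
  by rewrite !(subr_ge0, addr_ge0, mulr_ge0, sqr_ge0).
rewrite [ltRHS](_ : _ =
  s2 * (s3 * s1) + (s2 * (s3 * c2 + c1 * (s1 + c2) + (s3 + c2) * (s1 + c3))
  + k * c1 * (s1 * p2 + s2 + 2 * c3 + k * c3 ^+ 2) * (s3 + c1) * (s1 + c2)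
  + k * c3 * (s2 + s3 * p2 + 2 * c1 + k * c1 ^+ 2) * (s3 + c2) * (s1 + c3)
  + k * c1 ^+ 2 * (s3 + c2) * (s1 + c3)
  + k * (s3 + c1) * (c3 ^+ 2 * (s1 + c2) - p2 * c2 ^+ 2 * (s1 + c3))
  + (1 - p2) * (2 * c3 * (s3 + c1) * (s1 + c2) + 2 * c1 * (s3 + c2) * (s1 + c3))
  + p2 * (1 - p3) * s1 * (s3 + c1) * (s1 + c3)
  + p2 * (s1 * s3 * c3 + s1 * c1 * c3 + s1 * s3 * c1 + s3 * c1 * c3
          + 2 * c1 * c2 * c3 + s1 * c1 * c2 + s3 * c2 * c3))); last by ring.
by rewrite ltr_wpDr ?mulr_gt0 // !(subr_ge0, addr_ge0, mulr_ge0, sqr_ge0).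
Qed.

(* Sylvester's criterion, with the indices taken in the order 3, 1, 2. *)
Lemma form3_gt0 P11 P22 P33 P12 P13 P23 x y z :
  0 < P33 -> 0 < P11 * P33 - P13 ^+ 2 ->
  0 < P11 * (P22 * P33 - P23 ^+ 2) - P12 * (P12 * P33 - P23 * P13)
      + P13 * (P12 * P23 - P22 * P13) ->
  [|| x != 0, y != 0 | z != 0] ->
  0 < P11 * x ^+ 2 + P22 * y ^+ 2 + P33 * z ^+ 2
      + 2 * (P12 * x * y + P13 * x * z + P23 * y * z).
Proof.
move=> P33_gt0 m_gt0; set D := (X in 0 < X -> _) => D_gt0 xyz.
set Q := ltRHS; set m := P11 * P33 - P13 ^+ 2 in m_gt0 *.
(* Squares are completed twice, with pivots [P33] and then [m]; the coefficient left for [y] carries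
   the determinant [D]. *)
have E : m * P33 * Q = m * (P13 * x + P23 * y + P33 * z) ^+ 2 +
   (m * x + (P12 * P33 - P13 * P23) * y) ^+ 2 + P33 * D * y ^+ 2.
  by rewrite /Q /m /D; ring.
have sq_gt0 (u : R) : u != 0 -> 0 < u ^+ 2 by rewrite exprn_even_gt0.
have msq_ge0 u : 0 <= m * u ^+ 2 by rewrite mulr_ge0 ?sqr_ge0 // ltW.
rewrite -(pmulr_rgt0 _ (mulr_gt0 m_gt0 P33_gt0)) E.
have [y0|y0] := eqVneq y 0; last first.
  apply: ltr_wpDl; first by rewrite addr_ge0 ?msq_ge0 ?sqr_ge0.
  exact: mulr_gt0 (mulr_gt0 P33_gt0 D_gt0) (sq_gt0 _ y0).
move: xyz; rewrite y0 eqxx /= !mulr0 !addr0 expr0n mulr0 addr0 => xz.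
have [x0|x0] := eqVneq x 0; last first.
  apply: ltr_wpDl; first exact: msq_ge0.
  by rewrite sq_gt0 // mulf_neq0 // gt_eqF.
move: xz; rewrite x0 eqxx /= !mulr0 add0r expr0n addr0 => z0.
by rewrite mulr_gt0 ?sq_gt0 // mulf_neq0 // gt_eqF.
Qed.

Lemma sideC k e1 e2 c : side k e1 e2 c = side k e2 e1 c.
Proof. by rewrite /side; ring. Qed.

Lemma discC k x y z : disc k x y z = disc k y x z.
Proof. by rewrite /disc /dot; ring. Qed.

Lemma disc_rot k x y z : disc k x y z = disc k y z x.
Proof. by rewrite /disc /dot /sq; ring. Qed.

Lemma sq_gt0 k z : 0 <= k -> 0 < z -> 0 < sq k z.
Proof.
by move=> k0 z0; apply: ltr_wpDr; [exact: mulr_ge0 (sqr_ge0 z) | rewrite mulr_gt0].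
Qed.

Lemma side_gt0 k e1 e2 c :
  0 <= k -> 0 < e1 -> 0 < e2 -> 0 <= c -> 0 < side k e1 e2 c.
Proof.
move=> k0 e1_gt0 e2_gt0 c0; apply: ltr_wpDr => //.
apply: ltr_wpDr; last exact: addr_gt0.
by rewrite !mulr_ge0 // ltW.
Qed.

Lemma grow_gt0 k e1 e2 c :
  0 <= k -> 0 < e1 -> 0 < e2 -> 0 <= c -> 0 < grow k e1 e2 c.
Proof.
move=> k0 e1_gt0 e2_gt0 c0.
have C_gt0 e : 0 < e -> 0 < 1 + k * e 
  by move=> e_gt0; rewrite ltr_wpDr // mulr_ge0 // ltW.
apply: ltr_wpDr; last by rewrite mulr_gt0 ?sq_gt0 ?C_gt0.
by rewrite mulr_ge0 // ltW ?C_gt0.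
Qed.

(* Both sides are the same mixed partial derivative, up to a common factor. *)
Lemma grow_sym k e1 e2 e3 c1 c2 c3 (z1 := side k e2 e3 c1)
    (z2 := side k e3 e1 c2) (z3 := side k e1 e2 c3) :
  sq k z3 != 0 ->
  dot k z3 z1 z2 / sq k z3 * grow k e2 e1 c3 - grow k e2 e3 c1 =
  dot k z2 z3 z1 / sq k z3 * grow k e1 e2 c3 - grow k e1 e3 c2.
Proof.
move=> X3; apply: (mulfI X3).
have mulX u v w : sq k z3 * (u / sq k z3 * v - w) = u * v - sq k z3 * w.
  by field.
by rewrite !mulX /z1 /z2 /z3 /dot /sq /grow /side /sq; ring.
Qed.

(** The two off-diagonal entries are kept apart, since their equality comes from [grow_sym] and not
    from this identity. *)
Lemma principal_minorE k z1 z2 z3 g12 g13 g31 g32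
    (n1 := dot k z2 z3 z1) (n2 := dot k z3 z1 z2) (n3 := dot k z1 z2 z3) :
  sq k z1 != 0 -> sq k z2 != 0 -> sq k z3 != 0 ->
  (n3 / sq k z2 * g13 + n2 / sq k z3 * g12) *
    (n2 / sq k z1 * g32 + n1 / sq k z2 * g31) -
    (n1 / sq k z2 * g13 - g12) * (n3 / sq k z2 * g31 - g32) =
  disc k z1 z2 z3 / (sq k z1 * sq k z2 * sq k z3) *
   ((1 + k * z1) * sq k z3 * g32 * g13 + (1 + k * z3) * sq k z1 * g31 * g12
     - sq k z2 * g32 * g12).
Proof.
move=> X1 X2 X3; rewrite /n1 /n2 /n3 /disc; move: X1 X2 X3; rewrite /dot /sq.
by move=> X1 X2 X3; field; rewrite X1 X2 X3.
Qed.

(** Up to sign and a common factor, the matrix is the Jacobian of the angles in the edges times that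
    of the edges in the coordinates u; the last factor is the determinant of the second. The first
    is singular for [k = 0], by scaling invariance. *)
Lemma full_minorE k z1 z2 z3 g12 g13 g21 g23 g31 g32
    (n1 := dot k z2 z3 z1) (n2 := dot k z3 z1 z2) (n3 := dot k z1 z2 z3)
    (P11 := n3 / sq k z2 * g13 + n2 / sq k z3 * g12)
    (P22 := n1 / sq k z3 * g21 + n3 / sq k z1 * g23)
    (P33 := n2 / sq k z1 * g32 + n1 / sq k z2 * g31)
    (P12 := n2 / sq k z3 * g21 - g23) (P21 := n1 / sq k z3 * g12 - g13)
    (P23 := n3 / sq k z1 * g32 - g31) (P32 := n2 / sq k z1 * g23 - g21)
    (P31 := n1 / sq k z2 * g13 - g12) (P13 := n3 / sq k z2 * g31 - g32) :
  sq k z1 != 0 -> sq k z2 != 0 -> sq k z3 != 0 ->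
  P11 * (P22 * P33 - P23 * P32) - P12 * (P21 * P33 - P23 * P31) +
    P13 * (P21 * P32 - P22 * P31) =
  k * disc k z1 z2 z3 ^+ 2 / (sq k z1 * sq k z2 * sq k z3) *
   (g12 * g23 * g31 + g21 * g32 * g13).
Proof.
move=> X1 X2 X3.
rewrite /P11 /P22 /P33 /P12 /P21 /P23 /P32 /P31 /P13 /n1 /n2 /n3 /disc.
move: X1 X2 X3; rewrite /dot /sq.
by move=> X1 X2 X3; field; rewrite X1 X2 X3.
Qed.

(* Dividing by the factors [C e] (1 or cosh r) amounts to passing to the Klein
   model, where [s] is the square of [tanh r]. *)
Lemma minor_eq k e1 e2 e3 c1 c2 c3 (z1 := side k e2 e3 c1)
    (z2 := side k e3 e1 c2) (z3 := side k e1 e2 c3) (C := fun e => 1 + k * e)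
    (s := fun e => sq k e / C e ^+ 2) (p := fun e => (C e ^+ 2)^-1)
    (c1' := c1 / (C e2 * C e3)) (c2' := c2 / (C e3 * C e1))
    (c3' := c3 / (C e1 * C e2)) :
  C e1 != 0 -> C e2 != 0 -> C e3 != 0 ->
  (1 + k * z1) * sq k z3 * grow k e3 e2 c1 * grow k e1 e3 c2 +
  (1 + k * z3) * sq k z1 * grow k e3 e1 c2 * grow k e1 e2 c3 -
  sq k z2 * grow k e3 e2 c1 * grow k e1 e2 c3 =
  (C e1 * C e2 * C e3) ^+ 4 *
   ((1 + k * c1') * (s e1 * p e2 + s e2 + 2 * c3' + k * c3' ^+ 2) *
        (s e3 + c1') * (s e1 + c2') +
      (1 + k * c3') * (s e2 + s e3 * p e2 + 2 * c1' + k * c1' ^+ 2) *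
        (s e3 + c2') * (s e1 + c3') -
      p e2 * (s e1 * p e3 + s e3 + 2 * c2' + k * c2' ^+ 2) * (s e3 + c1')
        * (s e1 + c3')).
Proof.
rewrite /C => C1 C2 C3.
rewrite /z1 /z2 /z3 /s /p /c1' /c2' /c3' /C /grow /side /sq.
field; by rewrite C1 C2 C3.
Qed.

(** The expansion has two entries for each pair of vertices; [grow_sym] identifies them. *)
Lemma triformE k e1 e2 e3 c1 c2 c3 d1 d2 d3 (z1 := side k e2 e3 c1)
    (z2 := side k e3 e1 c2) (z3 := side k e1 e2 c3)
    (n1 := dot k z2 z3 z1) (n2 := dot k z3 z1 z2) (n3 := dot k z1 z2 z3)
    (P11 := n3 / sq k z2 * grow k e1 e3 c2 + n2 / sq k z3 * grow k e1 e2 c3)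
    (P22 := n1 / sq k z3 * grow k e2 e1 c3 + n3 / sq k z1 * grow k e2 e3 c1)
    (P33 := n2 / sq k z1 * grow k e3 e2 c1 + n1 / sq k z2 * grow k e3 e1 c2)
    (P12 := n2 / sq k z3 * grow k e2 e1 c3 - grow k e2 e3 c1)
    (P23 := n3 / sq k z1 * grow k e3 e2 c1 - grow k e3 e1 c2)
    (P31 := n1 / sq k z2 * grow k e1 e3 c2 - grow k e1 e2 c3) :
  sq k z1 != 0 -> sq k z2 != 0 -> sq k z3 != 0 ->
  - triform k e1 e2 e3 c1 c2 c3 d1 d2 d3 =
  P11 * d1 ^+ 2 + P22 * d2 ^+ 2 + P33 * d3 ^+ 2 +
  2 * (P12 * d1 * d2 + P31 * d1 * d3 + P23 * d2 * d3).
Proof.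
move=> X1 X2 X3.
have sym12 : n1 / sq k z3 * grow k e1 e2 c3 - grow k e1 e3 c2 = P12.
  by rewrite -grow_sym.
have sym23 : n2 / sq k z1 * grow k e2 e3 c1 - grow k e2 e1 c3 = P23.
  by rewrite -grow_sym.
have sym31 : n3 / sq k z2 * grow k e3 e1 c2 - grow k e3 e2 c1 = P31.
  by rewrite -grow_sym.
apply: (@eq_trans _ _ (P11 * d1 ^+ 2 + P22 * d2 ^+ 2 + P33 * d3 ^+ 2 +
    ((P12 + (n1 / sq k z3 * grow k e1 e2 c3 - grow k e1 e3 c2)) * d1 * d2 +
     (P31 + (n3 / sq k z2 * grow k e3 e1 c2 - grow k e3 e2 c1)) * d1 * d3 +
     (P23 + (n2 / sq k z1 * grow k e2 e3 c1 - grow k e2 e1 c3)) * d2 * d3))).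
  rewrite /triform /dangle /dside -/z1 -/z2 -/z3 /P11 /P22 /P33 /P12 /P23 /P31.
  by rewrite /n1 /n2 /n3 /dot; field; rewrite X1 X2 X3.
by rewrite sym12 sym23 sym31; ring.
Qed.

(** Divided by the three factors [1 + k * e], the two comparisons say that the product on the edge
    opposite to vertex 3 is the largest. This makes [n1] and [n2] positive, but not [n3]; the
    criterion starts from [P33], in which only [n1] and [n2] occur. *)
Lemma triform_lt0_max k e1 e2 e3 c1 c2 c3 d1 d2 d3 (z1 := side k e2 e3 c1)
    (z2 := side k e3 e1 c2) (z3 := side k e1 e2 c3) :
  0 <= k -> 0 < e1 -> 0 < e2 -> 0 < e3 -> 0 <= c1 -> 0 <= c2 ->
  (1 + k * e1) * c1 <= (1 + k * e3) * c3 ->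
  (1 + k * e2) * c2 <= (1 + k * e3) * c3 ->
  0 < disc k z1 z2 z3 ->
  nontrivial k d1 d2 d3 ->
  triform k e1 e2 e3 c1 c2 c3 d1 d2 d3 < 0.
Proof.
move=> k_ge0 e1_gt0 e2_gt0 e3_gt0 c1_ge0 c2_ge0 c13 c23 D_gt0; rewrite /nontrivial => d_neq.
have C_ge1 e : 0 < e -> 1 <= 1 + k * e.
  by move=> e_gt0; rewrite lerDl mulr_ge0 // ltW.
have [[C1 C2] C3] := (C_ge1 _ e1_gt0, C_ge1 _ e2_gt0, C_ge1 _ e3_gt0).
have C_gt0 e : 0 < e -> 0 < 1 + k * e by move/C_ge1; apply: lt_le_trans.
have C_ge0 e : 0 < e -> 0 <= 1 + k * e by move/C_gt0/ltW.
have c3_ge0 : 0 <= c3.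
  by rewrite -(pmulr_rge0 _ (C_gt0 _ e3_gt0)) (le_trans _ c13) ?mulr_ge0 ?C_ge0.
have [z1_gt0 z2_gt0 z3_gt0] : [/\ 0 < z1, 0 < z2 & 0 < z3].
  by rewrite !side_gt0.
have [[X1 X2] X3] := (sq_gt0 k_ge0 z1_gt0, sq_gt0 k_ge0 z2_gt0, sq_gt0 k_ge0 z3_gt0).
have [X1n X2n X3n] : [/\ sq k z1 != 0, sq k z2 != 0 & sq k z3 != 0].
  by rewrite !gt_eqF.
set n1 := dot k z2 z3 z1; set n2 := dot k z3 z1 z2; set n3 := dot k z1 z2 z3.
have n1_gt0 : 0 < n1.
  (* The only negative term, [- (1 + k * e1) * c1], is absorbed by the comparison with [c3]. *)
  rewrite [ltRHS](_ : _ = sq k e1 * (1 + k * e2) * (1 + k * e3) +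
    ((1 + k * e1) * (1 + k * e2) * c2 + k * c2 * c3 +
    k * e1 * ((1 + k * e3) * c3) + ((1 + k * e3) * c3 - (1 + k * e1) * c1)
    + k * e1 * c1)); last first.
    by rewrite /n1 /z1 /z2 /z3 /dot /side /sq; ring.
  apply: ltr_wpDr; last by rewrite !mulr_gt0 ?sq_gt0 ?C_gt0.
  by rewrite !(subr_ge0, addr_ge0, mulr_ge0, C_ge0) // ltW.
have n2_gt0 : 0 < n2.
  rewrite [ltRHS](_ : _ = sq k e2 * (1 + k * e1) * (1 + k * e3) +
    ((1 + k * e1) * (1 + k * e2) * c1 + k * c1 * c3 +
    k * e2 * ((1 + k * e3) * c3) + ((1 + k * e3) * c3 - (1 + k * e2) * c2)
    + k * e2 * c2)); last first.
    by rewrite /n2 /z1 /z2 /z3 /dot /side /sq; ring.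
  apply: ltr_wpDr; last by rewrite !mulr_gt0 ?sq_gt0 ?C_gt0.
  by rewrite !(subr_ge0, addr_ge0, mulr_ge0, C_ge0) // ltW.
have D_X : 0 < disc k z1 z2 z3 / (sq k z1 * sq k z2 * sq k z3).
  by rewrite divr_gt0 ?mulr_gt0.
set P31 := n1 / sq k z2 * grow k e1 e3 c2 - grow k e1 e2 c3.
have P31E : n3 / sq k z2 * grow k e3 e1 c2 - grow k e3 e2 c1 = P31.
  by rewrite -grow_sym.
set P11 := n3 / sq k z2 * grow k e1 e3 c2 + n2 / sq k z3 * grow k e1 e2 c3.
set P33 := n2 / sq k z1 * grow k e3 e2 c1 + n1 / sq k z2 * grow k e3 e1 c2.
have P33_gt0 : 0 < P33.
  by rewrite addr_gt0 ?mulr_gt0 ?invr_gt0 ?grow_gt0.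
have minor : 0 < P11 * P33 - P31 ^+ 2.
  (* One factor of the square becomes its mirror entry, which restores the unsymmetrized minor. *)
  rewrite expr2 -{2}P31E principal_minorE // mulr_gt0 // minor_eq ?gt_eqF ?C_gt0 //.
  rewrite mulr_gt0 ?exprn_gt0 ?mulr_gt0 ?C_gt0 //.
  have C_inv e : 0 < e -> 0 <= ((1 + k * e) ^+ 2)^-1 <= 1.
    move=> e_gt0; rewrite invr_ge0 sqr_ge0 invf_le1 ?exprn_gt0 ?C_gt0 //.
    by rewrite exprn_ege1 ?C_ge1.
  apply: minor_gt0; rewrite ?C_inv ?divr_gt0 ?exprn_gt0 ?sq_gt0 ?C_gt0 //.
  - by rewrite divr_ge0 ?mulr_ge0 ?C_ge0.
  - by rewrite divr_ge0 ?mulr_ge0 ?C_ge0.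
  - rewrite -subr_ge0 [leRHS](_ : _ = ((1 + k * e3) * c3 - (1 + k * e2) * c2) /
      ((1 + k * e1) * (1 + k * e2) * (1 + k * e3))); last first.
      by field; rewrite !gt_eqF ?C_gt0.
    by rewrite divr_ge0 ?subr_ge0 // !mulr_ge0 ?C_ge0.
rewrite -oppr_gt0 triformE // -/n1 -/n2 -/n3 -/z1 -/z2 -/z3 -/P11 -/P31 -/P33.
set P22 := n1 / sq k z3 * grow k e2 e1 c3 + n3 / sq k z1 * grow k e2 e3 c1.
set P12 := n2 / sq k z3 * grow k e2 e1 c3 - grow k e2 e3 c1.
set P23 := n3 / sq k z1 * grow k e3 e2 c1 - grow k e3 e1 c2.
have P12E : n1 / sq k z3 * grow k e1 e2 c3 - grow k e1 e3 c2 = P12.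
  by rewrite -grow_sym.
have P23E : n2 / sq k z1 * grow k e2 e3 c1 - grow k e2 e1 c3 = P23.
  by rewrite -grow_sym.
have [k0|k_neq0] := eqVneq k 0; last first.
  apply: form3_gt0 => //.
    have := full_minorE (grow k e1 e2 c3) (grow k e1 e3 c2) (grow k e2 e1 c3)
      (grow k e2 e3 c1) (grow k e3 e1 c2) (grow k e3 e2 c1) X1n X2n X3n.
    rewrite -/n1 -/n2 -/n3 -/P11 -/P22 -/P33 P12E P23E P31E -/P12 -/P23 -/P31.
    rewrite -!expr2 => ->.
    have k_gt0 : 0 < k by rewrite lt_def k_neq0.
    by rewrite mulr_gt0 ?divr_gt0 ?addr_gt0 ?mulr_gt0 ?grow_gt0 // exprn_gt0.
  move: d_neq; rewrite k_neq0 /= => /orP[|//]; apply: contraR.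
  rewrite !negb_or !negbK => /and3P[/eqP-> /eqP-> /eqP->].
  by rewrite eqxx.
(* For [k = 0] each row of the matrix sums to zero, since scaling preserves the angles; the form
   then depends on [d1 - d2] and [d3 - d2] alone. *)
have growD e e' c : grow k e e' c + grow k e' e c = sq k (side k e e' c).
  by rewrite /grow /side /sq k0; ring.
have dotD x y z : dot k x y z + dot k y z x = sq k y.
  by rewrite /dot /sq k0; ring.
have row1 : P11 + P12 + P31 = 0.
  rewrite -P31E.
  transitivity (n2 / sq k z3 * (grow k e1 e2 c3 + grow k e2 e1 c3) +
    n3 / sq k z2 * (grow k e3 e1 c2 + grow k e1 e3 c2) -
    (grow k e2 e3 c1 + grow k e3 e2 c1)); first by rewrite /P11 /P12; ring.
  by rewrite !growD -/z1 -/z2 -/z3 !divfK // addrC dotD; ring.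
have row2 : P12 + P22 + P23 = 0.
  rewrite -P12E.
  transitivity (n3 / sq k z1 * (grow k e2 e3 c1 + grow k e3 e2 c1) +
    n1 / sq k z3 * (grow k e1 e2 c3 + grow k e2 e1 c3) -
    (grow k e3 e1 c2 + grow k e1 e3 c2)); first by rewrite /P22 /P23; ring.
  by rewrite !growD -/z1 -/z2 -/z3 !divfK // addrC dotD; ring.
have row3 : P31 + P23 + P33 = 0.
  rewrite -P23E.
  transitivity (n1 / sq k z2 * (grow k e3 e1 c2 + grow k e1 e3 c2) +
    n2 / sq k z1 * (grow k e2 e3 c1 + grow k e3 e2 c1) -
    (grow k e1 e2 c3 + grow k e2 e1 c3)); first by rewrite /P31 /P33; ring.
  by rewrite !growD -/z1 -/z2 -/z3 !divfK // addrC dotD; ring.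
have P12_eq : P12 = - P11 - P31 by rewrite -[RHS]addr0 -row1; ring.
have P23_eq : P23 = - P31 - P33 by rewrite -[RHS]addr0 -row3; ring.
have P22_eq : P22 = P11 + P33 + 2 * P31.
  by rewrite -[RHS]addr0 -row2 P12_eq P23_eq; ring.
(* A dummy middle variable, with coefficient 1 and value 0, lets [form3_gt0] serve for a form in two
   variables. *)
rewrite P12_eq P23_eq P22_eq [ltRHS](_ : _ =
  P11 * (d1 - d2) ^+ 2 + 1 * 0 ^+ 2 + P33 * (d3 - d2) ^+ 2 +
  2 * (0 * (d1 - d2) * 0 + P31 * (d1 - d2) * (d3 - d2) + 0 * 0 * (d3 - d2)));
  last by ring.
apply: form3_gt0 => //.
  by rewrite [ltRHS](_ : _ = P11 * P33 - P31 ^+ 2) //; ring.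
move: d_neq; rewrite k0 eqxx /= orbF negb_and !subr_eq0.
by rewrite (eq_sym d2).
Qed.

Lemma triform_rot k e1 e2 e3 c1 c2 c3 d1 d2 d3 :
  triform k e1 e2 e3 c1 c2 c3 d1 d2 d3 = triform k e2 e3 e1 c2 c3 c1 d2 d3 d1.
Proof. by rewrite /triform /= [RHS]addrC addrA. Qed.

(** The data are cyclically symmetric, so a rotation moves the largest product to index 3. *)
Lemma triform_lt0 k e1 e2 e3 c1 c2 c3 d1 d2 d3 :
  0 <= k -> 0 < e1 -> 0 < e2 -> 0 < e3 -> 0 <= c1 -> 0 <= c2 -> 0 <= c3 ->
  0 < disc k (side k e2 e3 c1) (side k e3 e1 c2) (side k e1 e2 c3) ->
  nontrivial k d1 d2 d3 ->
  triform k e1 e2 e3 c1 c2 c3 d1 d2 d3 < 0.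
Proof.
move=> k_ge0 e1_gt0 e2_gt0 e3_gt0 c1_ge0 c2_ge0 c3_ge0 D_gt0; rewrite /nontrivial => d_neq.
have eq_rot (x y z : R) : (x == y) && (y == z) = (y == z) && (z == x).
  by apply/andP/andP => -[/eqP-> /eqP->].
have or_rot (x y z : R) : [|| x != 0, y != 0 | z != 0] = [|| y != 0, z != 0 | x != 0].
  by rewrite orbC orbA.
have max3 (x y z : R) : [\/ x <= z /\ y <= z, y <= x /\ z <= x | z <= y /\ x <= y].
  have [xy|/ltW yx] := leP x y; have [yz|/ltW zy] := leP y z.
  - by constructor 1; rewrite (le_trans xy).
  - by constructor 3.
  - by have [xz|/ltW zx] := leP x z; [constructor 1|constructor 2].
  - by constructor 2; rewrite (le_trans zy).
have [[le1 le2]|[le1 le2]|[le1 le2]] :=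
    max3 ((1 + k * e1) * c1) ((1 + k * e2) * c2) ((1 + k * e3) * c3).
- exact: triform_lt0_max k_ge0 e1_gt0 e2_gt0 e3_gt0 c1_ge0 c2_ge0 le1 le2 D_gt0 d_neq.
- rewrite disc_rot in D_gt0; rewrite eq_rot or_rot in d_neq; rewrite triform_rot.
  exact: triform_lt0_max k_ge0 e2_gt0 e3_gt0 e1_gt0 c2_ge0 c3_ge0 le1 le2 D_gt0 d_neq.
- rewrite -disc_rot in D_gt0; rewrite -eq_rot -or_rot in d_neq; rewrite -triform_rot.
  exact: triform_lt0_max k_ge0 e3_gt0 e1_gt0 e2_gt0 c3_ge0 c1_ge0 le1 le2 D_gt0 d_neq.
Qed.
End Algebra.

(** * Faces of a triangulation *)

Section Combinatorics.
Variables (N : nat) (T : triangulation N).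
Implicit Types i j k : 'I_N.

Definition is_face i j k := [set i; j; k] \in faces T.

Lemma is_face_rot i j k : is_face i j k = is_face j k i.
Proof. by rewrite /is_face -setUA setUC. Qed.

Lemma is_face_flip i j k : is_face i j k = is_face i k j.
Proof. by rewrite /is_face setUAC. Qed.

Lemma is_face_neq i j k : is_face i j k -> i != j.
Proof.
move=> /card_face; apply: contra_eq_neq => ->; rewrite setUid cards2.
by case: (j != k).
Qed.

Lemma is_face_edge i j k : is_face i j k -> [set i; j] \in edges T.
Proof.
move=> ijk; rewrite inE cards2 (is_face_neq ijk) /=.
by apply/existsP; exists [set i; j; k]; rewrite subsetUl andbT.
Qed.

Lemma vertex_in_face i : exists j k, is_face i j k.
Proof.
have [s [_ s_ge3 faceE]] := vertex_link T i.
case: s s_ge3 faceE => // j s _ faceE; exists j, (next (j :: s) j).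
by rewrite /is_face faceE mem_next !mem_head eqxx.
Qed.

(** Equality is carried along a path of edges: each edge lies in a face, whose third vertex is what
    remains when the edge is removed. *)
Lemma const_of_faces (X : Type) (d : 'I_N -> X) :
  (forall i j k, is_face i j k -> d i = d j) -> forall i j, d i = d j.
Proof.
move=> d_face i j; have /connectP[p] := vertices_connected T i j.
elim: p i => [i _ -> //|i' p IHp i] /= /andP[ii' i'p] j_last.
rewrite -(IHp i' i'p j_last); move: ii'; rewrite /Defs.adjacent inE.
case/andP=> /eqP card2 /existsP[f /andP[fT sub_f]].
have /eqP/cards1P[k fk] : #|f :\: [set i; i']| = 1%N.
  by rewrite cardsD (setIidPr sub_f) card2 (card_face fT).
apply: (d_face i i' k); rewrite /is_face -fk.
suff -> : [set i; i'] :|: f :\: [set i; i'] = f by [].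
apply/setP => x; move/subsetP/(_ x): sub_f; rewrite in_setU in_setD.
by case: (x \in [set i; i']) => //= ->.
Qed.

(** Turns a sum over corners into a sum over faces. The 6 is 3 cyclic shifts times 2 orders of [j]
    and [k]. *)
Lemma sum_faces_rot (R : numDomainType) (h : 'I_N -> 'I_N -> 'I_N -> R) :
  (forall i j k, is_face i j k -> h i j k = h i k j) ->
  6 * (\sum_(i < N) \sum_(j < N) \sum_(k < N | (j < k)%N && is_face i j k) h i j k) =
  \sum_i \sum_j \sum_(k | is_face i j k) (h i j k + h j k i + h k i j).
Proof.
move=> h_sym.
(* Extension by zero makes the index ranges independent, so that sums can be exchanged freely. *)
pose G i j k := if is_face i j k then h i j k else 0.
have GE : \sum_i \sum_j \sum_(k | is_face i j k) (h i j k + h j k i + h k i j) =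
    \sum_i \sum_j \sum_k (G i j k + G j k i + G k i j).
  apply: eq_bigr => i _; apply: eq_bigr => j _.
  rewrite big_mkcond; apply: eq_bigr => k _; rewrite /G.
  rewrite -(is_face_rot k i j) -(is_face_rot i j k).
  by rewrite (is_face_rot k i j); case: ifP => //; rewrite !addr0.
have sumG3 : \sum_i \sum_j \sum_(k | is_face i j k) (h i j k + h j k i + h k i j)
    = 3 * \sum_i \sum_j \sum_k G i j k.
  have G_rot : \sum_i \sum_j \sum_k G j k i = \sum_i \sum_j \sum_k G i j k.
    by rewrite exchange_big; apply: eq_bigr => j _; rewrite exchange_big.
  have G_rot2 : \sum_i \sum_j \sum_k G k i j = \sum_i \sum_j \sum_k G i j k.
    under eq_bigr do rewrite exchange_big.
    by rewrite exchange_big.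
  transitivity (\sum_i \sum_j \sum_k G i j k + \sum_i \sum_j \sum_k G j k i +
    \sum_i \sum_j \sum_k G k i j); last by rewrite G_rot G_rot2; ring.
  rewrite GE -!big_split; apply: eq_bigr => i _; rewrite -!big_split.
  by apply: eq_bigr => j _; rewrite -!big_split.
rewrite sumG3 (_ : 6 = 3 * 2 :> R); last by ring.
rewrite -mulrA; congr (_ * _); rewrite mulr_sumr; apply: eq_bigr => i _.
have half_sum (P : 'I_N -> 'I_N -> bool) :
    \sum_(j < N) \sum_(k < N | P j k && is_face i j k) h i j k =
    \sum_(j < N) \sum_(k < N | P j k) G i j k.
  by apply: eq_bigr => j _; rewrite big_mkcondr.
rewrite half_sum.
have split_jk j : \sum_k G i j k =
    \sum_(k < N | (j < k)%N) G i j k + \sum_(k < N | (k < j)%N) G i j k.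
  rewrite (bigID (fun k : 'I_N => (j < k)%N)) /=; congr (_ + _).
  rewrite (bigD1 j) /= ?ltnn // {1}/G.
  have -> : is_face i j j = false.
    by rewrite is_face_rot; apply/negP => /is_face_neq; rewrite eqxx.
  rewrite add0r; apply: eq_bigl => k.
  by rewrite -leqNgt ltn_neqAle andbC.
rewrite (eq_bigr _ (fun j _ => split_jk j)) big_split /= mulr_natl mulr2n.
congr (_ + _).
rewrite (exchange_big_dep predT) //=; apply: eq_bigr => j _; apply: eq_bigr => k _.
by rewrite /G is_face_flip; case: ifP => // /h_sym.
Qed.

End Combinatorics.

(** * Angles extended to degenerate triangles *)

Section Analysis.
Local Open Scope classical_set_scope.
Variable R : realType.
Implicit Types (f g : R -> R) (k q t x y z dx dy dz df dg : R).

Lemma seq_avoid (s : seq R) (a b : R) : a < b -> exists2 w, a < w < b & w \notin s.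
Proof.
(* The induction keeps a whole subinterval free of [s]; a single point could be hit by the next
   element. *)
move=> ab; suff [c [d [ac cd db cds]]] : exists c d,
    [/\ a <= c, c < d, d <= b & forall w, c < w < d -> w \notin s].
  have cw := midf_lt cd; exists ((c + d) / 2); last by rewrite cds // !cw.
  by rewrite (le_lt_trans ac) ?(lt_le_trans _ db) ?cw.
elim: s => [|v s [c [d [ac cd db cds]]]]; first by exists a, b.
have [cvd|cvd] := boolP (c < v < d).
  case/andP: cvd => cv vd; exists c, v; split=> //; first exact: le_trans (ltW vd) db.
  move=> w /andP[cw wv]; rewrite inE negb_or lt_eqF // cds // cw.
  exact: lt_trans wv vd.
exists c, d; split=> // w cwd; rewrite inE negb_or cds // andbT.
by apply: contraNneq cvd => <-.
Qed.

Lemma derive_lt0_right f (t df : R) : is_derive t 1 f df -> df < 0 ->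
  exists2 e, 0 < e & forall h, 0 < h < e -> f (t + h) < f t.
Proof.
move=> [fD <-] df_lt0.
have /cvgr_lt/(_ _ df_lt0) : (fun h => h^-1 *: ((f \o shift t) (h *: 1) - f t))
   @ 0^' --> 'D_1 f t by exact: fD.
rewrite /= => /nbhs_ballP[e /= e_gt0 He]; exists e => // h /andP[h_gt0 he].
have := He h; rewrite /ball /= sub0r normrN gtr0_norm // => /(_ he (lt0r_neq0 h_gt0)).
rewrite /shift /= scaler1 pmulr_rlt0 ?invr_gt0 // subr_lt0.
by rewrite addrC.
Qed.

(* If [f 1 >= f 0], pick a level [w] outside [s] between a value [f t0 < f 0] and
   [f 0]: at the last point where [f <= w], [f] would be decreasing. *)
Lemma lt_fun01 f (s : seq R) :
  (forall t, 0 <= t <= 1 -> {for t, continuous f}) ->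
  (forall t, 0 <= t <= 1 -> f t \in s \/ exists2 df, df < 0 & is_derive t 1 f df) ->
  (exists2 df, df < 0 & is_derive (0 : R) 1 f df) ->
  f 1 < f 0.
Proof.
move=> f_cont f_or [df df_lt0 f0_der].
have [e e_gt0 f_lt] := derive_lt0_right f0_der df_lt0.
have [t0 t0_01 ft0] : exists2 t0, 0 < t0 < 1 & f t0 < f 0.
  exists (Num.min e 1 / 2).
    have : 0 < Num.min e 1 <= 1 by rewrite lt_min e_gt0 ltr01 ge_min lexx orbT.
    by lra.
  rewrite -[X in f X < _]add0r f_lt //.
  have : 0 < Num.min e 1 <= e by rewrite lt_min e_gt0 ltr01 ge_min lexx.
  by lra.
rewrite ltNge; apply/negP => f01.
have [w /andP[t0w w0] ws] := seq_avoid s ft0.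
pose A := [set t | t0 <= t <= 1 /\ f t <= w].
have A_t0 : A t0.
  by split; [move: t0_01; rewrite lexx => /andP[_ /ltW] | exact: ltW].
have A_ub : ubound A 1 by move=> t [/andP[]].
have A_sup : has_sup A by split; [exists t0 | exists 1].
pose m := sup A.
have m_ge : t0 <= m by apply: ub_le_sup => //; exists 1.
have m_le : m <= 1 by apply: ge_sup => //; exists t0.
have m01 : 0 <= m <= 1 by move: t0_01; lra.
have fm_le : f m <= w.
  rewrite leNgt; apply/negP => w_fm.
  have /cvgr_gt/(_ _ w_fm)/nbhs_ballP[d /= d_gt0 Hd] := f_cont m m01.
  have [t At mdt] := sup_adherent d_gt0 A_sup.
  have tm : t <= m by apply: ub_le_sup; [exists 1|].
  suff /Hd : ball m d t by case: At => _ ftw; rewrite /= ltNge ftw.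
  by rewrite /ball /= ger0_norm; move: mdt; rewrite -/m; lra.
have m_lt1 : m < 1.
  rewrite lt_neqAle m_le andbT; apply/eqP => m1.
  by move: fm_le; rewrite m1 leNgt (lt_le_trans w0 f01).
suff [h h_gt0 [h1 fh]] : exists2 h, 0 < h & m + h <= 1 /\ f (m + h) <= w.
  have : m + h <= m.
    by apply: ub_le_sup; [exists 1 | split=> //; rewrite h1 andbT; lra].
  by lra.
have [e1 e1_gt0 f_lt1] : exists2 e1, 0 < e1 & forall h, 0 < h < e1 -> f (m + h) <= w.
  (* At the level [w] itself, which is outside [s], the negative derivative is available; below it,
     continuity suffices. *)
  move: fm_le; rewrite le_eqVlt => /orP[/eqP fmw|fm_lt].
    have [|[df' df'_lt0 fm_der]] := f_or m m01; first by rewrite fmw (negPf ws).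
    have [e1 e1_gt0 He] := derive_lt0_right fm_der df'_lt0.
    by exists e1 => // h /He/ltW; rewrite fmw.
  have /cvgr_lt/(_ _ fm_lt)/nbhs_ballP[d /= d_gt0 Hd] := f_cont m m01.
  exists d => // h /andP[h_gt0 hd]; apply/ltW/Hd.
  by rewrite /ball /= opprD addNKr normrN gtr0_norm.
exists (Num.min e1 (1 - m) / 2).
  have : 0 < Num.min e1 (1 - m) by rewrite lt_min e1_gt0 subr_gt0.
  by lra.
have mm : 0 < Num.min e1 (1 - m) <= 1 - m.
  by rewrite lt_min e1_gt0 subr_gt0 m_lt1 ge_min lexx orbT.
have me : 0 < Num.min e1 (1 - m) <= e1.
  by rewrite lt_min e1_gt0 subr_gt0 m_lt1 ge_min lexx.
by split; [lra | apply: f_lt1; lra].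
Qed.

(* [acos] has junk values outside [-1, 1], so the constant extension of
   the angle has to be built in. *)
Definition clamp (q : R) : R := Num.min (Num.max q (-1)) 1.

Lemma clamp_itv q : -1 <= clamp q <= 1.
Proof. by rewrite /clamp le_min le_max lexx orbT ge_min lexx !orbT /=; lra. Qed.

Lemma clamp_id (q : R) : -1 <= q <= 1 -> clamp q = q.
Proof. by case/andP=> q1 q2; rewrite /clamp (max_idPl q1) (min_idPl q2). Qed.

Lemma clamp_extreme (q : R) : 1 <= q ^+ 2 -> clamp q = 1 \/ clamp q = - 1.
Proof.
move=> q2; rewrite /clamp; have [q0|q0] := leP 0 q.
  have q1 : 1 <= q by nra.
  by left; rewrite max_l ?min_r //; lra.
have q1 : q <= -1 by nra.
by right; rewrite max_r ?min_l //; lra.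
Qed.

Lemma continuous_acos_clamp : continuous (acos \o clamp).
Proof.
have acos_cont : {within `[-1, 1], continuous (@acos R)}.
  rewrite -(@cospi R) -(@cos0 R).
  apply: (@segment_can_ge_continuous R 0 pi cos acos); first exact: pi_ge0.
    exact/continuous_subspaceT/continuous_cos.
  exact: cosK.
move=> q /=; have clamp_cont : {for q, continuous clamp}.
  apply: continuous_min; last exact: cst_continuous.
  by apply: continuous_max; [exact: cvg_id | exact: cst_continuous].
have /subspace_continuousP/(_ (clamp q)) := acos_cont.
rewrite /= in_itv /= clamp_itv => /(_ isT) acos_cvg P /acos_cvg Pq.
apply: (@filterS _ (nbhs q) _ _ _ _ (clamp_cont _ Pq)) => x /=.
by apply; rewrite in_itv /= clamp_itv.
Qed.

Lemma derivable_cont f t df : is_derive t 1 f df -> {for t, continuous f}.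
Proof. by move=> [fD _]; exact/differentiable_continuous/derivable1_diffP. Qed.

(** This and the next rules are stated for explicit lambda terms, so that derivatives of composites
    can be assembled as terms and adjusted by [is_derive_eq]. *)
Lemma der_add f g t df dg : is_derive t 1 f df -> is_derive t 1 g dg ->
  is_derive t 1 (fun u => f u + g u) (df + dg).
Proof. exact: is_deriveD. Qed.

Lemma der_sub f g t df dg : is_derive t 1 f df -> is_derive t 1 g dg ->
  is_derive t 1 (fun u => f u - g u) (df - dg).
Proof. exact: is_deriveB. Qed.

Lemma der_mul f g t df dg : is_derive t 1 f df -> is_derive t 1 g dg ->
  is_derive t 1 (fun u => f u * g u) (f t * dg + g t * df).
Proof. exact: is_deriveM. Qed.

Lemma der_cst (c t : R) : is_derive t 1 (fun=> c) 0.
Proof. exact: is_derive_cst. Qed.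

Lemma der_inv f t df : f t != 0 -> is_derive t 1 f df ->
  is_derive t 1 (fun u => (f u)^-1) (- df / f t ^+ 2).
Proof.
move=> f0 fD; apply: is_derive_eq (is_deriveV f0 fD) _.
by rewrite /GRing.scale /=; field.
Qed.

Lemma der_sqrt f t df : 0 < f t -> is_derive t 1 f df ->
  is_derive t 1 (fun u => Num.sqrt (f u)) (df / (2 * Num.sqrt (f t))).
Proof.
move=> f0 fD; apply: is_derive_eq (is_derive1_comp (is_derive1_sqrt f0) fD) _.
by rewrite mulrC.
Qed.

Definition tri_cos k x y z : R :=
  dot k x y z / (Num.sqrt (sq k x) * Num.sqrt (sq k y)).

Definition tri_angle k x y z : R := acos (clamp (tri_cos k x y z)).

(** This is the squared sine of the angle, so the sign of [disc] decides whether the cosine lies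
    strictly inside [(-1, 1)]. *)
Lemma tri_cos_sqr k x y z : 0 < sq k x -> 0 < sq k y ->
  1 - tri_cos k x y z ^+ 2 = disc k x y z / (sq k x * sq k y).
Proof.
move=> X Y; rewrite /tri_cos exprMn exprVn exprMn !sqr_sqrtr ?ltW //.
by rewrite /disc; field; rewrite !gt_eqF.
Qed.

Lemma tri_cos_itv k x y z : 0 < sq k x -> 0 < sq k y -> 0 < disc k x y z ->
  -1 < tri_cos k x y z < 1.
Proof.
move=> X Y D; rewrite -ltr_norml -(@ltr_pXn2r _ 2) ?nnegrE //.
rewrite real_normK ?num_real // expr1n -subr_gt0 tri_cos_sqr //.
by rewrite divr_gt0 ?mulr_gt0.
Qed.

Lemma der_tri_cos k (x y z : R -> R) t dx dy dz :
  0 < sq k (x t) -> 0 < sq k (y t) ->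
  is_derive t 1 x dx -> is_derive t 1 y dy -> is_derive t 1 z dz ->
  is_derive t 1 (fun u => tri_cos k (x u) (y u) (z u))
   (- dangle k (x t) (y t) (z t) dx dy dz /
     (Num.sqrt (sq k (x t)) * Num.sqrt (sq k (y t)))).
Proof.
move=> X Y xD yD zD.
have sq_der (v : R -> R) dv : is_derive t 1 v dv ->
    is_derive t 1 (fun u => sq k (v u)) (2 * (1 + k * v t) * dv).
  move=> vD.
  apply: is_derive_eq (der_add (der_mul (der_cst 2 t) vD)
    (der_mul (der_cst k t) (der_mul vD vD))) _.
  by ring.
have dot_der : is_derive t 1 (fun u => dot k (x u) (y u) (z u))
    ((1 + k * y t) * dx + (1 + k * x t) * dy - dz).
  apply: is_derive_eq (der_add (der_sub (der_add xD yD) zD)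
    (der_mul (der_mul (der_cst k t) xD) yD)) _.
  by ring.
have ab0 : Num.sqrt (sq k (x t)) * Num.sqrt (sq k (y t)) != 0.
  by rewrite mulf_neq0 // gt_eqF // sqrtr_gt0.
have aD := @der_sqrt (fun u => sq k (x u)) t _ X (sq_der _ _ xD).
have bD := @der_sqrt (fun u => sq k (y u)) t _ Y (sq_der _ _ yD).
pose ab u := Num.sqrt (sq k (x u)) * Num.sqrt (sq k (y u)).
apply: is_derive_eq (der_mul dot_der (@der_inv ab t _ ab0 (der_mul aD bD))) _.
rewrite {}/ab /=; set a := Num.sqrt (sq k (x t)); set b := Num.sqrt (sq k (y t)).
have [a0 b0] : a != 0 /\ b != 0 by rewrite !gt_eqF ?sqrtr_gt0.
have aE : a ^+ 2 = sq k (x t) by rewrite sqr_sqrtr // ltW.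
have bE : b ^+ 2 = sq k (y t) by rewrite sqr_sqrtr // ltW.
apply: (mulIf (mulf_neq0 a0 b0)); rewrite divfK ?mulf_neq0 //.
(* The roots are atoms for [field]; their squares are replaced only afterwards. *)
transitivity ((1 + k * y t) * dx + (1 + k * x t) * dy - dz -
    dot k (x t) (y t) (z t) *
      ((1 + k * x t) * dx / a ^+ 2 + (1 + k * y t) * dy / b ^+ 2)).
  by field; rewrite a0 b0.
rewrite aE bE /dangle; move/lt0r_neq0: X; move/lt0r_neq0: Y; rewrite /dot /sq.
by move=> X Y; field; rewrite X Y.
Qed.

(** Near [t] the cosine stays strictly between -1 and 1, where [clamp] is the identity and [acos] is
    differentiable. By [disc_rot] the root in the denominator is common to the three angles. *)
Lemma der_tri_angle k (x y z : R -> R) t dx dy dz :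
  0 < sq k (x t) -> 0 < sq k (y t) -> 0 < disc k (x t) (y t) (z t) ->
  is_derive t 1 x dx -> is_derive t 1 y dy -> is_derive t 1 z dz ->
  is_derive t 1 (fun u => tri_angle k (x u) (y u) (z u))
   (dangle k (x t) (y t) (z t) dx dy dz /
     Num.sqrt (disc k (x t) (y t) (z t))).
Proof.
move=> X Y D xD yD zD.
have qD := der_tri_cos X Y xD yD zD.
have q_itv := tri_cos_itv X Y D.
pose q u := tri_cos k (x u) (y u) (z u).
have near_q : \near t, (acos \o q) t = tri_angle k (x t) (y t) (z t).
  have q_cont : {for t, continuous q} := derivable_cont qD.
  have [q_gt q_lt] := andP q_itv.
  have near_gt : \forall u \near t, -1 < q u by exact: (cvgr_gt _ q_cont).
  have near_lt : \forall u \near t, q u < 1 by exact: (cvgr_lt _ q_cont).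
  near=> u; rewrite /tri_angle clamp_id //; apply/andP; split; apply: ltW.
    by near: u.
  by near: u.
apply: near_eq_is_derive near_q _.
apply: is_derive_eq (@is_derive1_comp _ _ q t _ _ (is_derive1_acos q_itv) qD) _.
rewrite tri_cos_sqr // sqrtrM ?ltW // sqrtrV ?mulr_ge0 ?ltW // sqrtrM ?ltW //.
field.
by rewrite !gt_eqF ?sqrtr_gt0.
Unshelve. all: by end_near.
Qed.

(** Supplies the finite set of exceptional values for [lt_fun01]. *)
Lemma tri_angle_degenerate k x y z : 0 < sq k x -> 0 < sq k y ->
  disc k x y z <= 0 -> tri_angle k x y z \in [:: acos 1; acos (-1)].
Proof.
move=> X Y D; have : 1 <= tri_cos k x y z ^+ 2.
  by rewrite -subr_le0 tri_cos_sqr // pmulr_lle0 // invr_gt0 mulr_gt0.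
by rewrite /tri_angle !inE => /clamp_extreme[]->; rewrite eqxx ?orbT.
Qed.

Lemma continuous_tri_angle k (x y z : R -> R) t dx dy dz :
  0 < sq k (x t) -> 0 < sq k (y t) ->
  is_derive t 1 x dx -> is_derive t 1 y dy -> is_derive t 1 z dz ->
  {for t, continuous (fun u => tri_angle k (x u) (y u) (z u))}.
Proof.
move=> X Y xD yD zD; have /derivable_cont q_cont := der_tri_cos X Y xD yD zD.
apply: (@continuous_comp _ _ _ (fun u => tri_cos k (x u) (y u) (z u))
  (acos \o clamp)) => //; exact: continuous_acos_clamp.
Qed.

(* For [t = exp u] (that is, [r / 2] or [tanh (r / 2)]): the code [e] of the
   radius [r], and [r] or [sinh r]. *)
Definition cosh_coord k t := 2 * t ^+ 2 / (1 - k * t ^+ 2).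
Definition sinh_coord k t := 2 * t / (1 - k * t ^+ 2).
Definition len_coord k (I s t : R) :=
  side k (cosh_coord k s) (cosh_coord k t) (I * sinh_coord k s * sinh_coord k t).

Lemma len_coordC k I s t : len_coord k I s t = len_coord k I t s.
Proof. by rewrite /len_coord sideC mulrAC. Qed.

Lemma cosh_coord_gt0 k t : 0 < t -> 0 < 1 - k * t ^+ 2 -> 0 < cosh_coord k t.
Proof. by move=> t0 k1; rewrite divr_gt0 // mulr_gt0 // exprn_gt0. Qed.

Lemma sinh_coord_gt0 k t : 0 < t -> 0 < 1 - k * t ^+ 2 -> 0 < sinh_coord k t.
Proof. by move=> t0 k1; rewrite divr_gt0 // mulr_gt0. Qed.

Lemma der_exp_path (a d t : R) :
  is_derive t 1 (fun u => a * expR (u * d)) (d * (a * expR (t * d))).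
Proof.
have idD : is_derive t 1 (fun u : R => u) 1 by exact: is_derive_id.
have := @is_derive1_comp _ expR (fun u => u * d) t _ _ (is_derive_expR _)
  (der_mul idD (der_cst d t)).
move=> eD; apply: is_derive_eq (der_mul (der_cst a t) eD) _.
by ring.
Qed.

(** Here [d] is the logarithmic derivative of [f], that is, the velocity of u. This rule and the
    next one are the source of the formula [grow]. *)
Lemma der_cosh_coord k f t d :
  1 - k * f t ^+ 2 != 0 -> is_derive t 1 f (d * f t) ->
  is_derive t 1 (fun u => cosh_coord k (f u)) (sq k (cosh_coord k (f t)) * d).
Proof.
move=> k1 fD; have f2D := der_mul fD fD.
pose den u := 1 - k * (f u * f u).
have denD := der_sub (der_cst 1 t) (der_mul (der_cst k t) f2D).
have den0 : den t != 0 by [].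
apply: is_derive_eq (der_mul (der_mul (der_cst 2 t) f2D) (@der_inv den t _ den0 denD)) _.
rewrite /sq /cosh_coord /den; field; exact: k1.
Qed.

Lemma der_sinh_coord k f t d :
  1 - k * f t ^+ 2 != 0 -> is_derive t 1 f (d * f t) ->
  is_derive t 1 (fun u => sinh_coord k (f u))
    (sinh_coord k (f t) * (1 + k * cosh_coord k (f t)) * d).
Proof.
move=> k1 fD; have f2D := der_mul fD fD.
pose den u := 1 - k * (f u * f u).
have denD := der_sub (der_cst 1 t) (der_mul (der_cst k t) f2D).
have den0 : den t != 0 by [].
apply: is_derive_eq (der_mul (der_mul (der_cst 2 t) fD) (@der_inv den t _ den0 denD)) _.
rewrite /sinh_coord /cosh_coord /den; field; exact: k1.
Qed.

Lemma der_len_coord k (I : R) f g t df dg :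
  1 - k * f t ^+ 2 != 0 -> 1 - k * g t ^+ 2 != 0 ->
  is_derive t 1 f (df * f t) -> is_derive t 1 g (dg * g t) ->
  is_derive t 1 (fun u => len_coord k I (f u) (g u))
    (dside k (cosh_coord k (f t)) (cosh_coord k (g t))
       (I * sinh_coord k (f t) * sinh_coord k (g t)) df dg).
Proof.
move=> kf kg fD gD.
have [feD geD] := (der_cosh_coord kf fD, der_cosh_coord kg gD).
have [fsD gsD] := (der_sinh_coord kf fD, der_sinh_coord kg gD).
apply: is_derive_eq (der_add (der_add (der_add feD geD)
  (der_mul (der_mul (der_cst k t) feD) geD))
  (der_mul (der_mul (der_cst I t) fsD) gsD)) _.
by rewrite /dside /grow; ring.
Qed.

End Analysis.

(** * Monotonicity of the angles *)

Section Monotone.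
Variable R : realType.
Implicit Types (k t d u I : R).

(** The values of exp u: all positive numbers for [k = 0], the interval [(0, 1)] for [k = 1]. *)
Definition coord_range k t := 0 < t /\ 0 < 1 - k * t ^+ 2.

(** The path is monotone between its endpoints, so the upper bound is inherited from the larger
    one. *)
Lemma exp_path_range k t0 t1 u : 0 <= k -> 0 <= u <= 1 ->
  coord_range k t0 -> coord_range k t1 ->
  coord_range k (t0 * expR (u * (ln t1 - ln t0))).
Proof.
move=> k_ge0 /andP[u0 u1] [t0_gt0 kt0] [t1_gt0 kt1].
have path_gt0 : 0 < t0 * expR (u * (ln t1 - ln t0)) by rewrite mulr_gt0 ?expR_gt0.
split=> //.
have kM (s : R) : 0 < s -> 0 < 1 - k * s ^+ 2 ->
    t0 * expR (u * (ln t1 - ln t0)) <= s ->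
    0 < 1 - k * (t0 * expR (u * (ln t1 - ln t0))) ^+ 2.
  move=> s_gt0 ks le_s; apply: (lt_le_trans ks); rewrite lerD2l lerN2.
  by rewrite ler_wpM2l // ler_pXn2r // nnegrE ltW.
have [le10|/ltW le01] := leP (ln t1) (ln t0).
  apply: (kM t0) => //; rewrite ger_pMr // -expR0 ler_expR.
  by rewrite mulr_ge0_le0 // subr_le0.
apply: (kM t1) => //.
rewrite [leRHS](_ : _ = t0 * expR (ln t1 - ln t0)).
  by rewrite ler_pM2l // ler_expR ler_piMl // subr_ge0.
by rewrite expRD expRN !lnK ?posrE // mulrC divfK ?gt_eqF.
Qed.

(** [I1] belongs to the edge opposite to vertex 1, so cyclic shifts of the arguments give the angles
    at the other vertices. *)
Definition corner k I1 I2 I3 t1 t2 t3 : R :=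
  tri_angle k (len_coord k I2 t3 t1) (len_coord k I3 t1 t2)
    (len_coord k I1 t2 t3).

(* Only the starting triangle has to be nondegenerate. *)
Lemma corner_angles_decrease k I1 I2 I3 t1 t2 t3 t1' t2' t3'
    (d1 := ln t1' - ln t1) (d2 := ln t2' - ln t2) (d3 := ln t3' - ln t3) :
  0 <= k -> 0 <= I1 -> 0 <= I2 -> 0 <= I3 ->
  coord_range k t1 -> coord_range k t2 -> coord_range k t3 ->
  coord_range k t1' -> coord_range k t2' -> coord_range k t3' ->
  0 < disc k (len_coord k I1 t2 t3) (len_coord k I2 t3 t1)
        (len_coord k I3 t1 t2) ->
  nontrivial k d1 d2 d3 ->
  d1 * corner k I1 I2 I3 t1' t2' t3' + d2 * corner k I2 I3 I1 t2' t3' t1'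
    + d3 * corner k I3 I1 I2 t3' t1' t2' <
  d1 * corner k I1 I2 I3 t1 t2 t3 + d2 * corner k I2 I3 I1 t2 t3 t1
    + d3 * corner k I3 I1 I2 t3 t1 t2.
Proof.
move=> k_ge0 I1_ge0 I2_ge0 I3_ge0 r1 r2 r3 r1' r2' r3' D_gt0 d_neq.
(* Geometric interpolation: the logarithms move linearly with velocities [d1], [d2], [d3]. *)
pose p1 u := t1 * expR (u * d1); pose p2 u := t2 * expR (u * d2).
pose p3 u := t3 * expR (u * d3).
pose z1 u := len_coord k I1 (p2 u) (p3 u).
pose z2 u := len_coord k I2 (p3 u) (p1 u).
pose z3 u := len_coord k I3 (p1 u) (p2 u).
pose a1 u := tri_angle k (z2 u) (z3 u) (z1 u).
pose a2 u := tri_angle k (z3 u) (z1 u) (z2 u).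
pose a3 u := tri_angle k (z1 u) (z2 u) (z3 u).
pose f u := d1 * a1 u + d2 * a2 u + d3 * a3 u.
have end1 t t' : coord_range k t -> coord_range k t' ->
    t * expR (1 * (ln t' - ln t)) = t'.
  move=> [t_gt0 _] [t'_gt0 _]; rewrite mul1r expRD expRN !lnK ?posrE //.
  by rewrite mulrC divfK ?gt_eqF.
have [p1_1 p2_1 p3_1] : [/\ p1 1 = t1', p2 1 = t2' & p3 1 = t3'].
  by rewrite /p1 /p2 /p3 !end1.
have [p1_0 p2_0 p3_0] : [/\ p1 0 = t1, p2 0 = t2 & p3 0 = t3].
  by rewrite /p1 /p2 /p3 !mul0r expR0 !mulr1.
suff : f 1 < f 0.
  by rewrite /f /a1 /a2 /a3 /z1 /z2 /z3 p1_1 p2_1 p3_1 p1_0 p2_0 p3_0.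
have path_range (u : R) : 0 <= u <= 1 ->
    [/\ coord_range k (p1 u), coord_range k (p2 u) & coord_range k (p3 u)].
  by move=> u01; split; apply: exp_path_range.
pose e t := cosh_coord k t.
pose c (I t t' : R) := I * sinh_coord k t * sinh_coord k t'.
pose z1' u := dside k (e (p2 u)) (e (p3 u)) (c I1 (p2 u) (p3 u)) d2 d3.
pose z2' u := dside k (e (p3 u)) (e (p1 u)) (c I2 (p3 u) (p1 u)) d3 d1.
pose z3' u := dside k (e (p1 u)) (e (p2 u)) (c I3 (p1 u) (p2 u)) d1 d2.
have zD (u : R) : 0 <= u <= 1 -> [/\ is_derive u 1 z1 (z1' u),
    is_derive u 1 z2 (z2' u) & is_derive u 1 z3 (z3' u)].
  move=> /path_range[[_ /lt0r_neq0 k1] [_ /lt0r_neq0 k2] [_ /lt0r_neq0 k3]].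
  have zD1 := @der_len_coord _ k I1 p2 p3 u d2 d3 k2 k3
    (der_exp_path t2 d2 u) (der_exp_path t3 d3 u).
  have zD2 := @der_len_coord _ k I2 p3 p1 u d3 d1 k3 k1
    (der_exp_path t3 d3 u) (der_exp_path t1 d1 u).
  have zD3 := @der_len_coord _ k I3 p1 p2 u d1 d2 k1 k2
    (der_exp_path t1 d1 u) (der_exp_path t2 d2 u).
  by split; [exact zD1|exact zD2|exact zD3].
have c_ge0 (I t t' : R) : 0 <= I -> coord_range k t -> coord_range k t' -> 0 <= c I t t'.
  move=> I_ge0 [t_gt0 kt] [t'_gt0 kt'].
  by apply: mulr_ge0; [apply: mulr_ge0 => //|]; apply/ltW/sinh_coord_gt0.
have e_gt0 (t : R) : coord_range k t -> 0 < e t.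
  by move=> [t_gt0 kt]; exact: cosh_coord_gt0.
have X_gt0 (u : R) : 0 <= u <= 1 ->
    [/\ 0 < sq k (z1 u), 0 < sq k (z2 u) & 0 < sq k (z3 u)].
  move=> /path_range[q1 q2 q3].
  by split; apply: sq_gt0 => //; apply: side_gt0; rewrite ?e_gt0 ?c_ge0.
have fD (u : R) : 0 <= u <= 1 -> 0 < disc k (z1 u) (z2 u) (z3 u) ->
    exists2 df, df < 0 & is_derive u 1 f df.
  move=> u01 Du.
  have [q1 q2 q3] := path_range u u01; have [X1 X2 X3] := X_gt0 u u01.
  have [zD1 zD2 zD3] := zD u u01.
  have Du1 : 0 < disc k (z2 u) (z3 u) (z1 u) by rewrite -disc_rot.
  have Du2 : 0 < disc k (z3 u) (z1 u) (z2 u) by rewrite disc_rot.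
  have aD1 := der_tri_angle X2 X3 Du1 zD2 zD3 zD1.
  have aD2 := der_tri_angle X3 X1 Du2 zD3 zD1 zD2.
  have aD3 := der_tri_angle X1 X2 Du zD1 zD2 zD3.
  exists (triform k (e (p1 u)) (e (p2 u)) (e (p3 u)) (c I1 (p2 u) (p3 u))
     (c I2 (p3 u) (p1 u)) (c I3 (p1 u) (p2 u)) d1 d2 d3 /
     Num.sqrt (disc k (z1 u) (z2 u) (z3 u))).
    rewrite pmulr_llt0 ?invr_gt0 ?sqrtr_gt0 //.
    by apply: triform_lt0; rewrite ?e_gt0 ?c_ge0.
  apply: is_derive_eq (der_add (der_add (der_mul (der_cst d1 u) aD1)
    (der_mul (der_cst d2 u) aD2)) (der_mul (der_cst d3 u) aD3)) _.
  rewrite -(disc_rot k (z1 u)) (disc_rot k (z3 u)) /triform.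
  rewrite -/(z1 u) -/(z2 u) -/(z3 u) -/(z1' u) -/(z2' u) -/(z3' u).
  by rewrite !mulr0 !addr0 !mulrA -!mulrDl.
(* At a degenerate triangle each angle is in [s], so [f] takes one of at most eight values. *)
pose s := [:: acos (1 : R); acos (-1)].
apply: (@lt_fun01 _ f [seq x + y | x <- [seq x + y | x <- map ( *%R d1) s,
  y <- map ( *%R d2) s], y <- map ( *%R d3) s]) => [u u01|u u01|].
- have [X1 X2 X3] := X_gt0 u u01; have [zD1 zD2 zD3] := zD u u01.
  have aC1 := continuous_tri_angle X2 X3 zD2 zD3 zD1.
  have aC2 := continuous_tri_angle X3 X1 zD3 zD1 zD2.
  have aC3 := continuous_tri_angle X1 X2 zD1 zD2 zD3.
  have cM (d : R) (g : R -> R) : {for u, continuous g} -> {for u, continuous (fun v => d * g v)}.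
    by move=> gC; apply: cvgM gC; exact: cvg_cst.
  exact: (cvgD (cvgD (cM _ _ aC1) (cM _ _ aC2)) (cM _ _ aC3)).
- have [Du|Du] := ltP 0 (disc k (z1 u) (z2 u) (z3 u)); first by right; exact: fD.
  have [X1 X2 X3] := X_gt0 u u01; left.
  have Du1 : disc k (z2 u) (z3 u) (z1 u) <= 0 by rewrite -disc_rot.
  have Du2 : disc k (z3 u) (z1 u) (z2 u) <= 0 by rewrite disc_rot.
  by apply: allpairs_f; [apply: allpairs_f|]; apply: map_f;
    apply: tri_angle_degenerate.
- apply: fD; first by rewrite lexx ler01.
  by rewrite /z1 /z2 /z3 p1_0 p2_0 p3_0.
Qed.

End Monotone.

(** * Monotonicity for one triangle with its equality case *)

Section Global.
Variable R : realType.
Implicit Types (k t d u I : R).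

Lemma tri_angleC k (x y z : R) : tri_angle k x y z = tri_angle k y x z.
Proof.
rewrite /tri_angle /tri_cos (mulrC (Num.sqrt _)); congr (acos (clamp (_ / _))).
by rewrite /dot; ring.
Qed.

Lemma tri_angle_scale (m x y z : R) : 0 < m -> 0 < x -> 0 < y ->
  tri_angle 0 (m * x) (m * y) (m * z) = tri_angle 0 x y z.
Proof.
move=> m_gt0 x_gt0 y_gt0; congr (acos (clamp _)); rewrite /tri_cos /dot /sq.
rewrite !mul0r !addr0 !(mulrCA 2 m) !(sqrtrM _ (ltW m_gt0)).
have -> : Num.sqrt m * Num.sqrt (2 * x) * (Num.sqrt m * Num.sqrt (2 * y)) =
   m * (Num.sqrt (2 * x) * Num.sqrt (2 * y)).
  by rewrite -{3}(sqr_sqrtr (ltW m_gt0)); ring.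
by field; rewrite !gt_eqF ?sqrtr_gt0 ?mulr_gt0.
Qed.

Lemma len_coord_scale (c I s t : R) :
  len_coord 0 I (c * s) (c * t) = c ^+ 2 * len_coord 0 I s t.
Proof.
rewrite /len_coord /side /cosh_coord /sinh_coord !mul0r !subr0 !invr1 !mulr1.
by ring.
Qed.

Lemma len_coord_gt0 k I s t : 0 <= k -> 0 <= I ->
  coord_range k s -> coord_range k t -> 0 < len_coord k I s t.
Proof.
move=> k_ge0 I_ge0 [s_gt0 ks] [t_gt0 kt]; apply: side_gt0 => //.
- exact: cosh_coord_gt0.
- exact: cosh_coord_gt0.
- by apply: mulr_ge0; [apply: mulr_ge0 => //|]; apply/ltW/sinh_coord_gt0.
Qed.

Lemma corner_scale (c I1 I2 I3 t1 t2 t3 : R) :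
  0 < c -> 0 <= I2 -> 0 <= I3 -> 0 < t1 -> 0 < t2 -> 0 < t3 ->
  corner 0 I1 I2 I3 (c * t1) (c * t2) (c * t3) = corner 0 I1 I2 I3 t1 t2 t3.
Proof.
move=> c_gt0 I2_ge0 I3_ge0 t1_gt0 t2_gt0 t3_gt0.
have range0 t : 0 < t -> coord_range 0 t by split; rewrite // mul0r subr0.
rewrite /corner !len_coord_scale tri_angle_scale ?exprn_gt0 //;
  apply: len_coord_gt0 => //; exact: range0.
Qed.

(** A trivial displacement is either a scaling with [k = 0], which preserves the angles, or zero,
    which kills every term. *)
Lemma corner_angles_le k (I1 I2 I3 t1 t2 t3 t1' t2' t3' : R)
    (d1 := ln t1' - ln t1) (d2 := ln t2' - ln t2) (d3 := ln t3' - ln t3)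
    (S := d1 * (corner k I1 I2 I3 t1' t2' t3' - corner k I1 I2 I3 t1 t2 t3) +
      d2 * (corner k I2 I3 I1 t2' t3' t1' - corner k I2 I3 I1 t2 t3 t1) +
      d3 * (corner k I3 I1 I2 t3' t1' t2' - corner k I3 I1 I2 t3 t1 t2)) :
  0 <= k -> 0 <= I1 -> 0 <= I2 -> 0 <= I3 ->
  coord_range k t1 -> coord_range k t2 -> coord_range k t3 ->
  coord_range k t1' -> coord_range k t2' -> coord_range k t3' ->
  0 < disc k (len_coord k I1 t2 t3) (len_coord k I2 t3 t1)
        (len_coord k I3 t1 t2) ->
  S <= 0 ?= iff ~~ nontrivial k d1 d2 d3.
Proof.
move=> k_ge0 I1_ge0 I2_ge0 I3_ge0 r1 r2 r3 r1' r2' r3' D_gt0.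
apply/leifP; have [d_triv|d_neq] := boolP (nontrivial k d1 d2 d3); last first.
  rewrite /=; move: d_neq; rewrite negb_or negbK => /andP[/andP[/eqP d12 /eqP d23]].
  rewrite negb_and !negb_or !negbK => /orP[/eqP k0|/and3P[/eqP d10 /eqP d20 /eqP d30]].
    have tE t t' : 0 < t -> 0 < t' -> t' = expR (ln t' - ln t) * t.
      by move=> t_gt0 t'_gt0; rewrite expRD expRN !lnK ?posrE // divfK ?gt_eqF.
    have [[[p1 _] [p2 _]] [p3 _]] := (r1, r2, r3).
    have [[[p1' _] [p2' _]] [p3' _]] := (r1', r2', r3').
    have t1E : t1' = expR d1 * t1 by exact: tE.
    have t2E : t2' = expR d1 * t2 by rewrite d12; exact: tE.
    have t3E : t3' = expR d1 * t3 by rewrite d12 d23; exact: tE.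
    apply/eqP; rewrite /S k0 t1E t2E t3E !corner_scale ?expR_gt0 //.
    by rewrite !subrr !mulr0 !addr0.
  by apply/eqP; rewrite /S d10 d20 d30 !mul0r !addr0.
have := corner_angles_decrease k_ge0 I1_ge0 I2_ge0 I3_ge0 r1 r2 r3 r1' r2' r3' D_gt0 d_triv.
rewrite -subr_lt0 [ltLHS](_ : _ = S) //.
by rewrite /S -/d1 -/d2 -/d3; ring.
Qed.

End Global.

(** * Rigidity of the total angles on the surface *)

Section Surface.
Variables (R : realType) (N : nat) (T : triangulation N).
Variables (k : R) (I : {set 'I_N} -> R).
Implicit Types (i j l : 'I_N) (t : 'I_N -> R).

Definition face_angle t i j l : R :=
  tri_angle k (len_coord k (I [set i; j]) (t i) (t j))
    (len_coord k (I [set i; l]) (t i) (t l))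
    (len_coord k (I [set j; l]) (t j) (t l)).

Definition nondegenerate t i j l : bool :=
  0 < disc k (len_coord k (I [set i; j]) (t i) (t j))
    (len_coord k (I [set i; l]) (t i) (t l))
    (len_coord k (I [set j; l]) (t j) (t l)).

Definition total_angle t i : R :=
  \sum_(j < N) \sum_(l < N | (j < l)%N && is_face T i j l) face_angle t i j l.

Lemma set2C (i j : 'I_N) : [set i; j] = [set j; i].
Proof. exact: setUC. Qed.

Lemma face_angleC t i j l : face_angle t i j l = face_angle t i l j.
Proof. by rewrite /face_angle tri_angleC (set2C j l) (len_coordC _ _ (t j)). Qed.

Lemma face_angle_corner t i j l : face_angle t i j l =
  corner k (I [set j; l]) (I [set l; i]) (I [set i; j]) (t i) (t j) (t l).
Proof. by rewrite face_angleC /face_angle /corner (set2C l) (set2C l)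
 !(len_coordC _ _ (t l)). Qed.

(** The sum of the [d i * c i] is nonnegative by hypothesis, and six times it is a sum of
    nonpositive face terms; so every term vanishes. The equality case makes [d] constant on each
    face, and connectedness makes it constant. *)
Lemma total_angle_rigid t t' (c : 'I_N -> R) (d := fun i => ln (t' i) - ln (t i)) :
  0 <= k -> (forall e, e \in edges T -> 0 <= I e) ->
  (forall i, coord_range k (t i)) -> (forall i, coord_range k (t' i)) ->
  (forall i j l, is_face T i j l -> nondegenerate t i j l) ->
  (forall i, total_angle t' i - total_angle t i = c i) ->
  (forall i, 0 <= d i * c i) ->
  [/\ forall i j, d i = d j, forall i, d i * c i = 0 &
      k != 0 -> forall i, d i = 0].
Proof.
move=> k_ge0 I_ge0 rt rt' nondeg angleE dc_ge0.
pose h i j l := d i * (face_angle t' i j l - face_angle t i j l).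
have sum_h : \sum_(i < N) \sum_(j < N) \sum_(l < N | (j < l)%N && is_face T i j l)
    h i j l = \sum_i d i * c i.
  apply: eq_bigr => i _; rewrite -angleE /total_angle -sumrB mulr_sumr.
  apply: eq_bigr => j _; rewrite -sumrB mulr_sumr.
  by apply: eq_bigr => l _.
have h_le i j l : is_face T i j l ->
    h i j l + h j l i + h l i j <= 0 ?= iff ~~ nontrivial k (d i) (d j) (d l).
  move=> ijl; have jli : is_face T j l i by rewrite -is_face_rot.
  have lij : is_face T l i j by rewrite is_face_rot.
  rewrite /h !face_angle_corner; apply: corner_angles_le;
    rewrite ?(I_ge0 _ (is_face_edge ijl)) ?(I_ge0 _ (is_face_edge jli))
      ?(I_ge0 _ (is_face_edge lij)) //.
  have := nondeg _ _ _ jli; rewrite /nondegenerate.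
  by rewrite (set2C j i) (len_coordC _ _ (t j) (t i)) discC disc_rot.
have h_sym i j l : is_face T i j l -> h i j l = h i l j.
  by move=> _; rewrite /h !(face_angleC _ i l j).
have := sum_faces_rot h_sym; rewrite sum_h => sum_eq.
have sum_le0 i j l : is_face T i j l -> 0 <= - (h i j l + h j l i + h l i j).
  by move=> /h_le[h_le0 _]; rewrite oppr_ge0.
pose H i j := \sum_(l | is_face T i j l) - (h i j l + h j l i + h l i j).
have H_ge0 i j : 0 <= H i j by apply: sumr_ge0 => l; exact: sum_le0.
have sumH : \sum_i \sum_j H i j = - (6 * \sum_i d i * c i).
  rewrite sum_eq -sumrN; apply: eq_bigr => i _; rewrite -sumrN.
  by apply: eq_bigr => j _; rewrite /H sumrN.
have dc_sum : \sum_i d i * c i = 0.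
  have ge0 : 0 <= \sum_i d i * c i by apply: sumr_ge0.
  have : 0 <= \sum_i \sum_j H i j by apply: sumr_ge0 => i _; apply: sumr_ge0.
  by rewrite sumH; lra.
have H0 i j l : is_face T i j l -> ~~ nontrivial k (d i) (d j) (d l).
  move=> ijl; rewrite -(h_le i j l ijl).
  have : \sum_i \sum_j H i j = 0 by rewrite sumH dc_sum mulr0 oppr0.
  move/psumr_eq0P => /(_ (fun i _ => sumr_ge0 _ (fun j _ => H_ge0 i j)) i isT).
  move/psumr_eq0P => /(_ (fun j _ => H_ge0 i j) j isT).
  move/psumr_eq0P => /(_ (sum_le0 i j) l ijl)/eqP.
  by rewrite oppr_eq0.
split.
- apply: const_of_faces => i j l /H0; rewrite negb_or negbK => /andP[/andP[/eqP-> _] _].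
  by [].
- by move=> i; move/psumr_eq0P: dc_sum => /(_ (fun i _ => dc_ge0 i) i isT).
- move=> k0 i; have [j [l /H0]] := vertex_in_face T i.
  rewrite negb_or k0 /= => /andP[_]; rewrite !negb_or !negbK.
  by case/and3P => /eqP.
Qed.

End Surface.

(** * The two background geometries *)

Section HyperbolicFunctions.
Variable R : realType.
Implicit Types x y a b : R.

Lemma cosh_ge1 x : 1 <= cosh x.
Proof.
have e_gt0 := expR_gt0 x; rewrite /cosh expRN ler_pdivlMr // mul1r -subr_ge0.
rewrite (_ : _ - 2 = (expR x - 1) ^+ 2 / expR x); last by field; rewrite gt_eqF.
by rewrite divr_ge0 ?sqr_ge0 // ltW.
Qed.

Lemma sinh_gt0 x : 0 < x -> 0 < sinh x.
Proof.
move=> x_gt0; rewrite /sinh divr_gt0 // subr_gt0 ltr_expR.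
by rewrite (lt_trans _ x_gt0) // oppr_lt0.
Qed.

Lemma cosh_sqr x : cosh x ^+ 2 = 1 + sinh x ^+ 2.
Proof. by rewrite /cosh /sinh expRN; field; rewrite gt_eqF ?expR_gt0. Qed.

Lemma coshB x y : cosh (x - y) = cosh x * cosh y - sinh x * sinh y.
Proof.
rewrite /cosh /sinh opprB !expRD !expRN.
by field; rewrite !gt_eqF ?expR_gt0.
Qed.

Lemma coshD x y : cosh (x + y) = cosh x * cosh y + sinh x * sinh y.
Proof.
rewrite /cosh /sinh opprD !expRD !expRN.
by field; rewrite !gt_eqF ?expR_gt0.
Qed.

Lemma cosh0 : cosh 0 = 1 :> R.
Proof. by rewrite /cosh oppr0 expR0; field. Qed.

(** Twice the difference factors into [expR y - expR x] and [1 - expR (- x - y)], both positive. *)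
Lemma ltr_cosh x y : x < y -> - x < y -> cosh x < cosh y.
Proof.
move=> xy Nxy; rewrite /cosh ltr_pM2r ?invr_gt0 // -subr_gt0.
rewrite (_ : _ - _ = (expR y - expR x) * (1 - expR (- x - y))).
  by rewrite mulr_gt0 ?subr_gt0 ?ltr_expR // expR_lt1; lra.
by rewrite expRD !expRN; field; rewrite !gt_eqF ?expR_gt0.
Qed.

(** In [X] all the half-argument identities become rational, within reach of [field]. *)
Lemma half_tanh x (X := expR (x / 2)) :
  [/\ expR x = X ^+ 2, tanh (x / 2) = (X ^+ 2 - 1) / (X ^+ 2 + 1) &
   X ^+ 2 + 1 != 0].
Proof.
have X_gt0 : 0 < X := expR_gt0 _.
have X2 : X ^+ 2 + 1 != 0 by rewrite gt_eqF // ltr_wpDl ?sqr_ge0.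
split=> //; first by rewrite expr2 -expRD -splitr.
rewrite /tanh /sinh /cosh expRN -/X; field.
by rewrite X2 !gt_eqF.
Qed.

Lemma cosh_half x : 1 + cosh_coord 1 (tanh (x / 2)) = cosh x.
Proof.
have [xE tE X2] := half_tanh x; rewrite tE /cosh_coord /cosh expRN xE.
have X_gt0 := expR_gt0 (x / 2).
have -> : 1 - 1 * ((expR (x / 2) ^+ 2 - 1) / (expR (x / 2) ^+ 2 + 1)) ^+ 2 =
   4 * expR (x / 2) ^+ 2 / (expR (x / 2) ^+ 2 + 1) ^+ 2 by field.
by field; rewrite X2 !gt_eqF.
Qed.

Lemma sinh_half x : sinh_coord 1 (tanh (x / 2)) = sinh x.
Proof.
have [xE tE X2] := half_tanh x; rewrite tE /sinh_coord /sinh expRN xE.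
have X_gt0 := expR_gt0 (x / 2).
have -> : 1 - 1 * ((expR (x / 2) ^+ 2 - 1) / (expR (x / 2) ^+ 2 + 1)) ^+ 2 =
   4 * expR (x / 2) ^+ 2 / (expR (x / 2) ^+ 2 + 1) ^+ 2 by field.
by field; rewrite X2 !gt_eqF.
Qed.

Lemma tanh_half_range x : 0 < x -> coord_range 1 (tanh (x / 2)).
Proof.
move=> x_gt0; have [xE tE X2] := half_tanh x; rewrite tE; split.
  by apply: divr_gt0; [rewrite subr_gt0 -xE expR_gt1 | rewrite ltr_wpDl ?sqr_ge0].
rewrite [ltRHS](_ : _ = 4 * expR (x / 2) ^+ 2 / (expR (x / 2) ^+ 2 + 1) ^+ 2).
  by rewrite divr_gt0 ?mulr_gt0 ?exprn_gt0 ?expR_gt0 // addr_gt0 ?exprn_gt0 ?expR_gt0.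
by field.
Qed.

(** [expR x] is [cosh x + sinh x], and both terms are functions of [tanh (x / 2)]. *)
Lemma tanh_half_inj x y : tanh (x / 2) = tanh (y / 2) -> x = y.
Proof.
move=> E; apply: expR_inj.
have expE (z : R) : expR z = cosh z + sinh z by rewrite /cosh /sinh; field.
by rewrite !expE -!cosh_half -!sinh_half E.
Qed.

End HyperbolicFunctions.

(** * The two geometries as the cases [k = 0] and [k = 1] *)

Section Background.
Variable R : realType.
Implicit Types (g : background) (x a b c : R).

Definition bg_curv g : R := if g is Hyperbolic then 1 else 0.
(** Halving the Euclidean radius makes [cosh_coord 0] return [x ^+ 2 / 2] and [sinh_coord 0] return
    [x]. *)
Definition bg_coord g x : R := if g is Hyperbolic then tanh (x / 2) else x / 2.
Definition bg_length g x : R := if g is Hyperbolic then cosh x - 1 else x ^+ 2 / 2.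

Lemma bg_curv_ge0 g : 0 <= bg_curv g.
Proof. by case: g => //=; rewrite ler01. Qed.

Lemma bg_coord_range g x : 0 < x -> coord_range (bg_curv g) (bg_coord g x).
Proof.
case: g => /= x_gt0; last exact: tanh_half_range.
by split; rewrite ?divr_gt0 // mul0r subr0.
Qed.

Lemma bg_coord_inj g x y : bg_coord g x = bg_coord g y -> x = y.
Proof.
case: g => /=; last exact: tanh_half_inj.
by apply: mulIf; rewrite invr_eq0 pnatr_eq0.
Qed.

(** Heron's formula and its hyperbolic analogue: [disc] factors into terms made positive by the
    triangle inequalities. *)
Lemma bg_disc_gt0 g a b c :
  0 < a -> 0 < b -> 0 < c -> a < b + c -> b < a + c -> c < a + b ->
  0 < disc (bg_curv g) (bg_length g a) (bg_length g b) (bg_length g c).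
Proof.
move=> a_gt0 b_gt0 c_gt0 ltA ltB ltC; case: g => /=.
  rewrite [ltRHS](_ : _ = (a + b + c) * (a + b - c) * (b + c - a) * (a + c - b) / 4).
    by rewrite divr_gt0 // !mulr_gt0 ?subr_gt0 ?addr_gt0.
  by rewrite /disc /dot /sq; field.
rewrite [ltRHS](_ : _ = (cosh (a + b) - cosh c) * (cosh c - cosh (a - b))).
  by rewrite mulr_gt0 // subr_gt0 ltr_cosh //; lra.
rewrite coshB coshD.
transitivity ((cosh a ^+ 2 - 1) * (cosh b ^+ 2 - 1) - (cosh a * cosh b - cosh c) ^+ 2).
  by rewrite /disc /dot /sq; ring.
by rewrite !cosh_sqr; ring.
Qed.

Lemma bg_angleE g a b c :
  0 < a -> 0 < b -> 0 < c -> a < b + c -> b < a + c -> c < a + b ->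
  angle g a b c = tri_angle (bg_curv g) (bg_length g a) (bg_length g b) (bg_length g c).
Proof.
move=> a_gt0 b_gt0 c_gt0 ltA ltB ltC.
have D_gt0 := bg_disc_gt0 g a_gt0 b_gt0 c_gt0 ltA ltB ltC.
have len_gt0 x : 0 < x -> 0 < bg_length g x.
  case: g {D_gt0} => x_gt0 /=; first by rewrite divr_gt0 ?exprn_gt0.
  by rewrite subr_gt0 -cosh0 ltr_cosh //; lra.
have X_gt0 x : 0 < x -> 0 < sq (bg_curv g) (bg_length g x).
  by move=> x_gt0; rewrite sq_gt0 ?bg_curv_ge0 ?len_gt0.
have /andP[q1 q2] := tri_cos_itv (X_gt0 _ a_gt0) (X_gt0 _ b_gt0) D_gt0.
rewrite /tri_angle clamp_id ?ltW //.
case: g {D_gt0 len_gt0 X_gt0 q1 q2} => /=; congr acos; rewrite /tri_cos.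
  have sqrtE x : 0 < x -> Num.sqrt (sq 0 (x ^+ 2 / 2)) = x.
    move=> x_gt0; rewrite (_ : sq 0 _ = x ^+ 2) ?sqrtr_sqr ?gtr0_norm //.
    by rewrite /sq; field.
  by rewrite !sqrtE // /dot; field; rewrite !gt_eqF.
have sqrtE x : 0 < x -> Num.sqrt (sq 1 (cosh x - 1)) = sinh x.
  move=> x_gt0; rewrite (_ : sq 1 _ = sinh x ^+ 2).
    by rewrite sqrtr_sqr gtr0_norm ?sinh_gt0.
  by rewrite -[RHS](addKr 1) -cosh_sqr /sq; ring.
by rewrite !sqrtE // /dot; congr (_ / _); ring.
Qed.

Lemma edge_lengthE g N (I : {set 'I_N} -> R) (r : 'I_N -> R) i j :
  0 <= I [set i; j] -> 0 < r i -> 0 < r j ->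
  0 < edge_length g I r i j /\
  bg_length g (edge_length g I r i j) =
    len_coord (bg_curv g) (I [set i; j]) (bg_coord g (r i)) (bg_coord g (r j)).
Proof.
move=> I_ge0 ri_gt0 rj_gt0; case: g => /=.
  have l2_gt0 : 0 < r i ^+ 2 + r j ^+ 2 + 2 * r i * r j * I [set i; j].
    apply: ltr_wpDr; first by rewrite !mulr_ge0 // ltW.
    by rewrite addr_gt0 ?exprn_gt0.
  rewrite sqrtr_gt0 sqr_sqrtr ?ltW //; split=> //.
  by rewrite /len_coord /side /cosh_coord /sinh_coord; field.
set y := cosh (r i) * _ + _.
(* Above 1, [arcosh] is meaningful and the length is positive. *)
have y_gt1 : 1 < y.
  apply: ltr_wpDr.
    by apply: mulr_ge0; [apply: mulr_ge0 => //|]; apply/ltW/sinh_gt0.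
  have c_gt1 x : 0 < x -> 1 < cosh x.
    by move=> x_gt0; rewrite -cosh0 ltr_cosh //; lra.
  by rewrite (lt_le_trans (c_gt1 _ ri_gt0)) // ler_peMr ?cosh_ge1 // (le_trans ler01) ?cosh_ge1.
split; last first.
  rewrite arcoshK ?ltW // /y -!cosh_half -!sinh_half /len_coord /side; ring.
by rewrite /arcosh ln_gt0 // ltr_wpDr ?sqrtr_ge0.
Qed.

Lemma edge_lengthC g N (I : {set 'I_N} -> R) (r : 'I_N -> R) i j :
  edge_length g I r i j = edge_length g I r j i.
Proof.
case: g => /=; first by rewrite (set2C i) (addrC (r i ^+ 2)) (mulrAC 2).
by rewrite (set2C i) (mulrC (cosh _)) (mulrAC (I _)).
Qed.

End Background.

(** * Rigidity of circle packing metrics *)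

Section Packing.
Variables (R : realType) (N : nat) (T : triangulation N) (I : {set 'I_N} -> R).
Variable g : background.
Variable I_ge0 : forall e, e \in edges T -> 0 <= I e.
Implicit Types r : 'I_N -> R.

Let coord r i := bg_coord g (r i).

Lemma admissible_face r i j l : admissible g T I r -> is_face T i j l ->
  nondegenerate (bg_curv R g) I (coord r) i j l /\
  inner_angle g I r i j l = face_angle (bg_curv R g) I (coord r) i j l.
Proof.
move=> [r_gt0 tri] ijl.
have ilj : is_face T i l j by rewrite -is_face_flip.
have jli : is_face T j l i by rewrite -is_face_rot.
have [eij lij] := edge_lengthE g (I_ge0 (is_face_edge ijl)) (r_gt0 i) (r_gt0 j).
have [eil lil] := edge_lengthE g (I_ge0 (is_face_edge ilj)) (r_gt0 i) (r_gt0 l).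
have [ejl ljl] := edge_lengthE g (I_ge0 (is_face_edge jli)) (r_gt0 j) (r_gt0 l).
have tij := tri _ _ _ ijl; have til := tri _ _ _ ilj; have tjl := tri _ _ _ jli.
rewrite (edge_lengthC g I r l j) in tij.
rewrite (edge_lengthC g I r j i) in tjl.
rewrite /nondegenerate /face_angle -lij -lil -ljl; split.
  by apply: bg_disc_gt0.
by apply: bg_angleE.
Qed.

Lemma curvatureE r i : admissible g T I r ->
  curvature g T I r i = 2 * pi - total_angle T (bg_curv R g) I (coord r) i.
Proof.
move=> adm; congr (_ - _); apply: eq_bigr => j _; apply: eq_bigr => l /andP[_ ijl].
by have [] := admissible_face adm ijl.
Qed.

(** Since [Rbar] is nonpositive and the curvature is [Rbar] times an increasing function of the
    coordinate, the changes of total angle have the sign that [total_angle_rigid] asks for. *)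
Lemma R_curvature_rigid (Rbar : 'I_N -> R) r r'
    (d := fun i => ln (coord r' i) - ln (coord r i)) :
  (forall i, Rbar i <= 0) -> admissible g T I r -> admissible g T I r' ->
  (forall i, R_curvature g T I r i = Rbar i) ->
  (forall i, R_curvature g T I r' i = Rbar i) ->
  [/\ forall i j, d i = d j, forall i, Rbar i != 0 -> d i = 0 &
      g = Hyperbolic -> forall i, d i = 0].
Proof.
move=> Rbar_le0 adm adm' rR r'R.
(* The Euclidean coordinate is [r / 2], so the denominator [r ^+ 2] is 4 times its square. *)
pose m : R := if g is Hyperbolic then 1 else 4.
have m_gt0 : 0 < m by rewrite /m; case: (g).
have coord_gt0 s i : admissible g T I s -> 0 < coord s i.
  by case=> s_gt0 _; case: (bg_coord_range g (s_gt0 i)).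
have KE s i : admissible g T I s -> (forall i, R_curvature g T I s i = Rbar i) ->
    curvature g T I s i = Rbar i * (m * coord s i ^+ 2).
  move=> adm_s sR; have c_neq0 := lt0r_neq0 (coord_gt0 s i adm_s).
  move: c_neq0; rewrite -sR /R_curvature /m /coord /bg_coord.
  case: (g) => c_neq0.
    have s_neq0 : s i != 0 by apply: contraNneq c_neq0 => ->; rewrite mul0r.
    by field.
  by rewrite mul1r divfK // expf_neq0.
have mono i : 0 <= d i * (coord r' i ^+ 2 - coord r i ^+ 2)
    /\ (d i * (coord r' i ^+ 2 - coord r i ^+ 2) = 0 -> d i = 0).
  have [c_gt0 c'_gt0] := (coord_gt0 r i adm, coord_gt0 r' i adm').
  rewrite subr_sqr /d; case: (ltgtP (coord r i) (coord r' i)) => [lt|lt|->].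
  - have ln_lt : 0 < ln (coord r' i) - ln (coord r i) by rewrite subr_gt0 ltr_ln ?posrE.
    have P : 0 < (ln (coord r' i) - ln (coord r i)) *
        ((coord r' i - coord r i) * (coord r' i + coord r i)).
      by rewrite (mulr_gt0 ln_lt) // mulr_gt0 ?subr_gt0 ?addr_gt0.
    by split; [exact: ltW | move=> E; rewrite E ltxx in P].
  - have ln_lt : ln (coord r' i) - ln (coord r i) < 0 by rewrite subr_lt0 ltr_ln ?posrE.
    have P : 0 < (ln (coord r' i) - ln (coord r i)) *
        ((coord r' i - coord r i) * (coord r' i + coord r i)).
      by rewrite (nmulr_rgt0 _ ln_lt) nmulr_rlt0 ?subr_lt0 // addr_gt0.
    by split; [exact: ltW | move=> E; rewrite E ltxx in P].
  - by rewrite subrr mul0r.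
pose c i := - Rbar i * (m * (coord r' i ^+ 2 - coord r i ^+ 2)).
have dcE i : d i * c i = - Rbar i * (m * (d i * (coord r' i ^+ 2 - coord r i ^+ 2))).
  by rewrite /c; ring.
have [] := @total_angle_rigid _ _ T (bg_curv R g) I (coord r) (coord r') c
  (bg_curv_ge0 _ g) I_ge0.
- by move=> i; case: adm => r_gt0 _; exact: bg_coord_range.
- by move=> i; case: adm' => r_gt0 _; exact: bg_coord_range.
- by move=> i j l ijl; case: (admissible_face adm ijl).
- move=> i; have := KE r i adm rR; have := KE r' i adm' r'R.
  rewrite !curvatureE // /c => E' E.
  set a := total_angle _ _ _ _ i in E' *; set b := total_angle _ _ _ _ i in E *.
  have -> : a - b = 2 * pi - b - (2 * pi - a) by ring.
  by rewrite E E'; ring.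
- move=> i; rewrite -/(d i) dcE; apply: mulr_ge0; first by rewrite oppr_ge0.
  by rewrite mulr_ge0 ?(ltW m_gt0) //; case: (mono i).
move=> d_const dc0 d0; split=> //.
- move=> i Rbar_neq0; case: (mono i) => _; apply; apply/eqP.
  have /eqP := dc0 i; rewrite -/(d i) dcE mulf_eq0 oppr_eq0 (negPf Rbar_neq0) /=.
  by rewrite mulf_eq0 gt_eqF.
- by move=> gH; apply: d0; rewrite gH /= oner_neq0.
Qed.

Lemma coord_eq r r' : admissible g T I r -> admissible g T I r' ->
  (forall i, ln (coord r' i) - ln (coord r i) = 0) -> r = r'.
Proof.
move=> [r_gt0 _] [r'_gt0 _] d0; apply: funext => i; apply: (@bg_coord_inj _ g).
have [[c_gt0 _] [c'_gt0 _]] := (bg_coord_range g (r_gt0 i), bg_coord_range g (r'_gt0 i)).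
by apply: ln_inj; rewrite ?posrE //; apply/esym/eqP; rewrite -subr_eq0; apply/eqP/d0.
Qed.

End Packing.

Theorem theorem1p1 (R : realType) (N : nat) (T : triangulation N)
  (I : {set 'I_N} -> R) (Rbar : 'I_N -> R)
  (I_ge0 : forall e, e \in edges T -> 0 <= I e)
  (chi_le0 : euler_number T <= 0) :
  [/\ (forall i, Rbar i = 0) ->
      forall r r' : 'I_N -> R,
        admissible Euclidean T I r -> admissible Euclidean T I r' ->
        (forall i, R_curvature Euclidean T I r i = Rbar i) ->
        (forall i, R_curvature Euclidean T I r' i = Rbar i) ->
        exists2 c : R, 0 < c & forall i, r' i = c * r i,
      (forall i, Rbar i <= 0) -> ~ (forall i, Rbar i = 0) ->
      forall r r' : 'I_N -> R,
        admissible Euclidean T I r -> admissible Euclidean T I r' ->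
        (forall i, R_curvature Euclidean T I r i = Rbar i) ->
        (forall i, R_curvature Euclidean T I r' i = Rbar i) ->
        r = r'
    & (forall i, Rbar i <= 0) ->
      forall r r' : 'I_N -> R,
        admissible Hyperbolic T I r -> admissible Hyperbolic T I r' ->
        (forall i, R_curvature Hyperbolic T I r i = Rbar i) ->
        (forall i, R_curvature Hyperbolic T I r' i = Rbar i) ->
        r = r'].
Proof.
split=> [Rbar0|Rbar_le0 Rbar_neq0|Rbar_le0] r r' adm adm' rR r'R.
- have Rbar_le0 i : Rbar i <= 0 by rewrite Rbar0.
  have [d_const _ _] := R_curvature_rigid I_ge0 Rbar_le0 adm adm' rR r'R.
  (* All ratios [r' i / r i] agree, so any vertex yields the constant. *)
  pose i0 := Ordinal (vertices_gt0 T).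
  exists (expR (ln (r' i0 / 2) - ln (r i0 / 2))); first exact: expR_gt0.
  move=> i; have /= -> := d_const i0 i.
  have [[r_gt0 _] [r'_gt0 _]] := (adm, adm').
  rewrite expRD expRN !lnK ?posrE ?divr_gt0 //; field.
  by rewrite gt_eqF.
- have [d_const d0 _] := R_curvature_rigid I_ge0 Rbar_le0 adm adm' rR r'R.
  (* The constant displacement vanishes at a vertex where [Rbar] is nonzero, hence everywhere. *)
  have [i1 Ri1] : exists i, Rbar i != 0.
    apply/not_existsP => Rbar0; apply: Rbar_neq0 => i; apply/eqP.
    by have /negP := Rbar0 i; rewrite negbK.
  apply: (coord_eq adm adm') => i; rewrite -[RHS](d0 i1 Ri1); exact: d_const.
- have [_ _ d0] := R_curvature_rigid I_ge0 Rbar_le0 adm adm' rR r'R.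
  by apply: (coord_eq adm adm'); exact: d0.
Qed.
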